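(* For every $\beta$ with $5/3<\beta<2$, there exists a set $A\subset\mathbb{R}^2$ with $0<\mathcal{H}^\beta(A)<\infty$ which is not $\mathcal{C}$-tube null.
   Context: $\mathcal{H}^\beta$ is $\beta$-dimensional Hausdorff measure. $\mathcal{C}$ is the family of curves in $\mathbb{R}^2$ which are graphs of a convex function $f:[0,1]\to\mathbb{R}$. A $\mathcal{C}$-tube $T$ of width $w=w(T)>0$ is the $w$-neighborhood of some curve in $\mathcal{C}$. A set $A\subset\mathbb{R}^2$ is $\mathcal{C}$-tube null if for every $\delta>0$ there is a countable covering $\{T_j\}$ of $A$ by $\mathcal{C}$-tubes with $\sum_j w(T_j)<\delta$. *)

(* Defs.v *)
From mathcomp Require Import all_boot all_order all_algebra.
From mathcomp Require Import all_classical all_reals all_analysis.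

Set Implicit Arguments.
Unset Strict Implicit.
Unset Printing Implicit Defensive.

Import Order.TTheory GRing.Theory Num.Theory.

Local Open Scope classical_set_scope.
Local Open Scope ring_scope.

(* The library's norm and metric on [R * R] are those of the maximum norm, so
   the Euclidean distance is spelled out. *)
Definition edist2 (R : realType) (x y : R * R) : R :=
  Num.sqrt ((x.1 - y.1) ^+ 2 + (x.2 - y.2) ^+ 2).

(* The maximum with [0] makes the diameter of the empty set [0], since
   [ereal_sup set0 = -oo]. *)
Definition diam2 (R : realType) (U : set (R * R)) : \bar R :=
  maxe 0%E (ereal_sup [set d | exists x y, [/\ U x, U y & d = (edist2 x y)%:E]]).

(* Coverings indexed by [nat] include the finite ones, as [U j] may be empty. *)
Definition hausdorff_pre (R : realType) (s delta : R) (A : set (R * R)) :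
    \bar R :=
  ereal_inf [set m | exists U : nat -> set (R * R),
    [/\ A `<=` \bigcup_j U j,
        (forall j, diam2 (U j) <= delta%:E)%E &
        m = (\sum_(0 <= j <oo) poweR (diam2 (U j)) s)%E]].

(* Hausdorff (outer) measure, normalized so that a set [U] of a covering
   contributes [diam U ^ s], without a volume constant; meant for [s > 0]. *)
Definition hausdorff_measure (R : realType) (s : R) (A : set (R * R)) :
    \bar R :=
  ereal_sup [set hausdorff_pre s delta A | delta in [set delta : R | 0 < delta]].

Definition graph01 (R : realType) (f : R -> R) : set (R * R) :=
  [set p | p.1 \in `[0, 1] /\ p.2 = f p.1].

(* Only the values of [f] on [0, 1] matter. *)
Definition convex_curve (R : realType) (G : set (R * R)) : Prop :=
  exists2 f : R -> R, convex_function (`[0, 1]%classic : set R) f &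
                      G = graph01 f.

Definition neighborhood2 (R : realType) (w : R) (G : set (R * R)) :
    set (R * R) :=
  [set x | exists2 y, G y & edist2 x y < w].

Definition convex_tube (R : realType) (w : R) (T : set (R * R)) : Prop :=
  0 < w /\ exists2 G, convex_curve G & T = neighborhood2 w G.

(* The index set [J] ranges over all subsets of [nat], so finite coverings are
   included although tubes are never empty. *)
Definition convex_tube_null (R : realType) (A : set (R * R)) : Prop :=
  forall delta : R, 0 < delta ->
    exists (J : set nat) (T : nat -> set (R * R)) (w : nat -> R),
      [/\ forall j, J j -> convex_tube (w j) (T j),
          A `<=` \bigcup_(j in J) T j &
          (\esum_(j in J) (w j)%:E < delta%:E)%E].

(* Main.v *)
(* A set that is not tube null may be enlarged at will, so the positive finite
   measure can be supplied by a four corner Cantor set of ratio [4 `^ (- 1 / beta)],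
   added to a compact set [A1] of finite measure, possibly null, that is not tube
   null.

   [A1] is an intersection of unions of grid cells, at scales [L i] so sparse that
   every stage only has to be compared with a scale tending to zero. The invariant
   is that each curve [y = g x] or [x = g y], with [g] 1-Lipschitz and convex or
   concave, meets the cells of stage [i] in at most twice the expected proportion of
   equally spaced samples; a convex curve is covered by three such curves, one for
   each range of slopes. Counting the cells that meet a tube of width [w] then costs
   [O(w)] of all cells, and compactness forbids covers of small total width.

   To refine a stage, the square is cut into windows of [H] columns of new cells,
   and in each window the same random [H * H] pattern of density [1 / q] is copied.
   Over most windows a convex curve is nearly a line: the slope jumps add up to at
   most 2, so only [O(H)] windows, whatever their number [W], contain a large jump.
   Chernoff's bound makes the pattern meet all the [O(H ^ 3)] digital lines with the
   right frequency as soon as [H / q] exceeds a power of [log H]. The exceptional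
   windows are negligible when [W] is a large multiple of [q * H]; since [q] is
   nearly [H], the new scale is nearly [H ^ 3] and the density nearly its power
   [- 1 / 3], which is where the dimension [5 / 3] comes from. *)
Require Import Defs.
From mathcomp Require Import all_boot all_order all_algebra.
From mathcomp Require Import all_classical all_reals all_analysis.
From mathcomp Require Import zify ring lra.

Import Order.TTheory GRing.Theory Num.Theory.
Import numFieldNormedType.Exports.

Local Open Scope classical_set_scope.
Local Open Scope ring_scope.

(** * Random patterns *)

Lemma sum_block (n k : nat) (F : nat -> nat) :
  (\sum_(i < n * k) F i = \sum_(i < n) \sum_(j < k) F (i * k + j))%N.
Proof.
rewrite -(big_mkord predT F) big_nat_mul big_mkord.
apply: eq_bigr => i _; rewrite -{1}[(i * k)%N]add0n big_addn mulSn addnK.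
by rewrite big_mkord; apply: eq_bigr => j _; rewrite addnC.
Qed.

(* Chernoff: [exp (eps / (1 + eps)) <= 1 + eps] replaces the Taylor expansion of
   the logarithm. *)
Lemma few_hits_selection (R : realType) (B I : finType) (q : nat)
    (F : I -> B -> 'I_q -> bool) (eps mu : R) :
  0 < eps <= 1 -> (0 < q)%N -> 0 <= mu ->
  (forall i, (\sum_b \sum_c F i b c)%N%:R = mu * q%:R) ->
  #|I|%:R * expR (- (eps ^+ 2 * mu)) < 1 ->
  exists phi : {ffun B -> 'I_q},
    forall i, (\sum_b F i b (phi b))%N%:R <= (1 + 3 * eps) * mu.
Proof.
move=> /andP[e0 e1] q0 mu0 hF hI; apply: contrapT => /forallNP hn.
have qR : 0 < q%:R :> R by rewrite ltr0n.
pose t := eps / (1 + eps).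
have e1p : 0 < 1 + eps by rewrite addr_gt0.
have t0 : 0 <= t by rewrite divr_ge0 ?ltW.
have tle : expR t <= 1 + eps.
  have := expR_ge1Dx (- t); rewrite expRN.
  have -> : 1 + - t = (1 + eps)^-1 by rewrite /t; field; rewrite gt_eqF.
  by rewrite lef_pV2 ?posrE ?expR_gt0.
pose X i (phi : {ffun B -> 'I_q}) := (\sum_b F i b (phi b))%N.
pose K := expR (- (t * ((1 + 3 * eps) * mu))).
(* If every [phi] fails at some [i], then for each [phi] the exponential weights add up to at least
   1; summed over all [phi], this contradicts the moment bound [gen]. *)
have one phi : 1 <= \sum_i (1 + eps) ^+ X i phi * K.
  have /existsNP[i /negP] := hn phi; rewrite -ltNge => hi.
  rewrite (bigD1 i) //= -[leLHS]addr0; apply: lerD; last first.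
    by apply: sumr_ge0 => j _; rewrite mulr_ge0 ?exprn_ge0 ?expR_ge0 ?ltW.
  apply: le_trans (_ : (expR t) ^+ X i phi * K <= _); last first.
    apply: ler_wpM2r; first exact: expR_ge0.
    by apply: lerXn2r; rewrite ?nnegrE ?expR_ge0 ?(ltW e1p).
  rewrite -expRM_natl -expRD -[leLHS]expR0 ler_expR mulrC -mulrBr.
  by rewrite mulr_ge0 // subr_ge0 ltW.
(* The values of [phi] at different [b] are independent, so the moment sum factors over [b], and
   each factor is bounded through [1 + x <= expR x]. *)
have gen i : \sum_phi (1 + eps) ^+ X i phi <= q%:R ^+ #|B| * expR (eps * mu).
  have -> : \sum_phi (1 + eps) ^+ X i phi =
      \sum_(phi : {ffun B -> 'I_q}) \prod_b (1 + eps) ^+ F i b (phi b).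
    by apply: eq_bigr => phi _; rewrite expr_sum.
  rewrite -(bigA_distr_bigA (fun b c => (1 + eps) ^+ F i b c)).
  have hb b : \sum_c (1 + eps) ^+ F i b c =
      q%:R * (1 + eps * (\sum_c F i b c)%N%:R / q%:R).
    rewrite mulrDr mulr1 mulrCA mulfV ?gt_eqF // mulr1 natr_sum mulr_sumr.
    have -> : (q%:R : R) = \sum_(c < q) 1 by rewrite sumr_const card_ord.
    rewrite -big_split /=.
    by apply: eq_bigr => c _; case: (F i b c);
      rewrite /= ?expr1 ?expr0 ?mulr1 ?mulr0 ?addr0.
  rewrite (eq_bigr _ (fun b _ => hb b)) big_split /= prodr_const.
  apply: ler_wpM2l; first by rewrite exprn_ge0.
  have -> : eps * mu = \sum_b eps * (\sum_c F i b c)%N%:R / q%:R.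
    rewrite -mulr_suml -mulr_sumr -natr_sum hF; field; by rewrite gt_eqF.
  rewrite expR_sum; apply: ler_prod => b _; rewrite expR_ge1Dx andbT.
  by rewrite addr_ge0 // divr_ge0 // mulr_ge0 // ltW.
have : (q%:R ^+ #|B| : R) <= #|I|%:R * (q%:R ^+ #|B| * expR (eps * mu) * K).
  rewrite [leLHS](_ : _ = \sum_(phi : {ffun B -> 'I_q}) 1); last first.
    by rewrite sumr_const card_ffun card_ord natrX.
  apply: le_trans (ler_sum _ (fun phi _ => one phi)) _.
  rewrite exchange_big /= -sum1_card natr_sum mulr_suml; apply: ler_sum => i _.
  rewrite mul1r -mulr_suml; apply: ler_wpM2r; first exact: expR_ge0.
  exact: gen.
apply/negP; rewrite -ltNge.
apply: le_lt_trans (_ : q%:R ^+ #|B| * (#|I|%:R * expR (- (eps ^+ 2 * mu))) < _).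
  rewrite -mulrA mulrCA; apply: ler_wpM2l; first by rewrite exprn_ge0.
  apply: ler_wpM2l; first by rewrite ler0n.
  rewrite -expRD ler_expR -subr_ge0.
  (* The factor 3 leaves this surplus in the exponent, nonnegative because [eps <= 1]. *)
  have -> : - (eps ^+ 2 * mu) - (eps * mu + - (t * ((1 + 3 * eps) * mu))) =
      mu * (eps ^+ 2 * (1 - eps) / (1 + eps)).
    by rewrite /t; field; rewrite gt_eqF.
  rewrite mulr_ge0 // divr_ge0 ?(ltW e1p) //.
  by rewrite mulr_ge0 ?subr_ge0 // exprn_ge0 // ltW.
by rewrite -[ltRHS]mulr1 ltr_pM2l ?exprn_gt0.
Qed.

Lemma sum_pred1 (n x : nat) (P : nat -> bool) :
  (x < n)%N -> (\sum_(r < n) (P r && (r == x :> nat)) = P x)%N.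
Proof.
move=> xn; rewrite (bigD1 (Ordinal xn)) //= eqxx andbT big1 ?addn0 //.
by move=> i; rewrite -val_eqE /= => /negbTE ->; rewrite andbF.
Qed.

(* The rows, modulo [H], of the cells met by the line of slope [v / (4 D H)]
   and height [u / (4 D)] at [0]. *)
Definition line_row (D H u v k : nat) : nat :=
  ((u * H + v * k) %/ (4 * D * H) %% H)%N.

(** Each column gets one random cell in each of its [b] blocks of [q] rows, so a line hits [b] cells
    on average. The union bound runs over both orientations and all pairs [(u, v)], which gives the
    factor [32 * D ^ 2 * H ^ 3]. *)
Lemma line_pattern_nat (R : realType) (eps : R) (D b q : nat) :
  0 < eps <= 1 -> (0 < D)%N -> (0 < b)%N -> (0 < q)%N ->
  (32 * D ^ 2 * (b * q) ^ 3)%N%:R * expR (- (eps ^+ 2 * b%:R)) < 1 ->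
  exists Q : nat -> nat -> bool,
    (\sum_(k < b * q) \sum_(r < b * q) Q k r = b * q * b)%N /\
    forall u v, (u < 4 * D * (b * q))%N -> (v < 4 * D * (b * q) ^ 2)%N ->
    (\sum_(k < b * q) Q k (line_row D (b * q) u v k))%N%:R <= (1 + 3 * eps) * b%:R
    /\ (\sum_(k < b * q) Q (line_row D (b * q) u v k) k)%N%:R
         <= (1 + 3 * eps) * b%:R.
Proof.
move=> heps D0 b0 q0 hE; set H := (b * q)%N.
have H0 : (0 < H)%N by rewrite muln_gt0 b0.
have ltH u v k : (line_row D H u v k < H)%N by rewrite ltn_mod.
have sum1H : (\sum_(r < H) 1 = H)%N by rewrite sum1_card card_ord.
pose I : finType := (bool * ('I_(4 * D * H) * 'I_(4 * D * H ^ 2)))%type.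
pose F (i : I) (kB : 'I_H * 'I_b) (c : 'I_q) : bool :=
  let r := (kB.2 * q + c)%N in
  if i.1 then line_row D H i.2.1 i.2.2 r == kB.1
  else r == line_row D H i.2.1 i.2.2 kB.1.
have sumF i : (\sum_kB \sum_c F i kB c = H)%N.
  rewrite -(pair_bigA _ (fun k B => \sum_c F i (k, B) c)%N) /=.
  rewrite (eq_bigr (fun k : 'I_H => \sum_(r < b * q) (if i.1 then
     line_row D H i.2.1 i.2.2 r == k else r == line_row D H i.2.1 i.2.2 k :> nat)))%N;
    last first.
    move=> k _; rewrite (sum_block b q (fun r => if i.1 then
      line_row D H i.2.1 i.2.2 r == k else r == line_row D H i.2.1 i.2.2 k)).
    by apply: eq_bigr => B _.
  case: i => [[] [u v]] /=.
    rewrite exchange_big /= -[RHS]sum1H; apply: eq_bigr => r _.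
    apply: etrans (sum_pred1 _ _ predT (ltH u v r)).
    by apply: eq_bigr => k _; rewrite eq_sym.
  rewrite -[RHS]sum1H; apply: eq_bigr => k _.
  exact: (sum_pred1 _ _ predT (ltH u v k)).
have sumF' i : (\sum_kB \sum_c F i kB c)%N%:R = b%:R * q%:R :> R.
  by rewrite sumF natrM.
have [|phi hphi] := few_hits_selection R ('I_H * 'I_b)%type I q F eps b%:R
    heps q0 (ler0n _ _) sumF'.
  apply: le_lt_trans hE; apply: ler_wpM2r; first exact: expR_ge0.
  rewrite ler_nat !card_prod card_bool !card_ord; nia.
(* [phi] read on natural numbers; the default 0 is never met, since all sums stay in range. *)
pose f (k B : nat) : nat :=
  if insub k is Some k' then
    if insub B is Some B' then phi (k', B') else 0%N
  else 0%N.
have fE (k : 'I_H) (B : 'I_b) : f k B = phi (k, B) by rewrite /f !valK.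
pose Q (k r : nat) := f k (r %/ q)%N == (r %% q)%N.
have QE (k : 'I_H) (B : 'I_b) (c : 'I_q) :
    Q k (B * q + c)%N = (phi (k, B) == c).
  by rewrite /Q divnMDl // divn_small // addn0 fE modnMDl modn_small.
have sumQ (G : nat -> nat -> bool) :
    (\sum_(k < H) \sum_(r < H) (Q k r && G k r) =
     \sum_(kB : 'I_H * 'I_b) G kB.1 (kB.2 * q + phi kB)%N)%N.
  transitivity (\sum_(kB : 'I_H * 'I_b)
      G kB.1 (kB.2 * q + phi (kB.1, kB.2)))%N; last by apply: eq_bigr => -[].
  rewrite -(pair_bigA _ (fun (k : 'I_H) (B : 'I_b) =>
    nat_of_bool (G k (B * q + phi (k, B))%N))) /=.
  apply: eq_bigr => k _; rewrite (sum_block b q (fun r => Q k r && G k r)).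
  apply: eq_bigr => B _.
  rewrite -(sum_pred1 q (phi (k, B)) (fun c => G k (B * q + c)%N)) //.
  by apply: eq_bigr => c _; rewrite QE andbC eq_sym.
exists Q; split.
  transitivity (\sum_(k < H) \sum_(r < H) (Q k r && true))%N.
    by apply: eq_bigr => k _; apply: eq_bigr => r _; rewrite andbT.
  by rewrite (sumQ (fun _ _ => true)) sum1_card card_prod !card_ord.
move=> u v hu hv; split.
- apply: le_trans (hphi (false, (Ordinal hu, Ordinal hv))).
  rewrite ler_nat -(sumQ (fun k r => r == line_row D H u v k)).
  by apply: leq_sum => k _; rewrite sum_pred1.
- apply: le_trans (hphi (true, (Ordinal hu, Ordinal hv))).
  rewrite ler_nat -(sumQ (fun k r => line_row D H u v r == k)) exchange_big /=.
  apply: leq_sum => r _; rewrite -(sum_pred1 H _ (fun k => Q k r)) //.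
  by apply: leq_sum => k _; rewrite [_ == _ :> nat]eq_sym.
Qed.

(** The row depends on [u] only modulo [4 * D * H] and on [v] only modulo [4 * D * H ^ 2], so the
    finite family already represents all integer parameters. *)
Lemma line_pattern (R : realType) (eps : R) (D b q : nat) :
  0 < eps <= 1 -> (0 < D)%N -> (0 < b)%N -> (0 < q)%N ->
  (32 * D ^ 2 * (b * q) ^ 3)%N%:R * expR (- (eps ^+ 2 * b%:R)) < 1 ->
  exists Q : nat -> nat -> bool,
    (\sum_(k < b * q) \sum_(r < b * q) Q k r = b * q * b)%N /\
    forall u v : int,
    let row k := `|(((u * (b * q)%N + v * k%:Z) %/ (4 * D * (b * q))%N)%Z
                      %% (b * q)%N)%Z|%N in
    (\sum_(k < b * q) Q k (row k))%N%:R <= (1 + 3 * eps) * b%:R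
    /\ (\sum_(k < b * q) Q (row k) k)%N%:R <= (1 + 3 * eps) * b%:R.
Proof.
move=> heps D0 b0 q0 /(line_pattern_nat _ _ _ _ _ heps D0 b0 q0) [Q [sQ hQ]].
exists Q; split=> // u v row.
have H0 : (0 < b * q)%N by rewrite muln_gt0 b0.
set H := (b * q)%N in H0 row hQ *.
have m1 : (0 < 4 * D * H)%N by rewrite !muln_gt0 D0 b0 q0.
have m2 : (0 < 4 * D * H ^ 2)%N by rewrite !muln_gt0 D0 b0 q0.
pose u' := `|(u %% (4 * D * H)%N)%Z|%N; pose v' := `|(v %% (4 * D * H ^ 2)%N)%Z|%N.
have u'E : u'%:Z = (u %% (4 * D * H)%N)%Z by rewrite gez0_abs // modz_ge0; lia.
have v'E : v'%:Z = (v %% (4 * D * H ^ 2)%N)%Z by rewrite gez0_abs // modz_ge0; lia.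
have rowE k : row k = line_row D H u' v' k.
  rewrite /row /line_row {1}(divz_eq u (4 * D * H)%N) -u'E.
  rewrite {1}(divz_eq v (4 * D * H ^ 2)%N) -v'E.
  set U := (u %/ _)%Z; set V := (v %/ _)%Z.
  have -> : (U * (4 * D * H)%N + u') * H + (V * (4 * D * H ^ 2)%N + v') * k%:Z =
    (U * H + V * H * k%:Z) * (4 * D * H)%N + (u' * H + v' * k)%N%:Z by lia.
  rewrite divzMDl; last by lia.
  have -> : U * H + V * H * k%:Z = (U + V * k%:Z) * H by lia.
  by rewrite modzMDl divz_nat modz_nat.
have hu : (u' < 4 * D * H)%N by rewrite -ltz_nat u'E ltz_pmod.
have hv : (v' < 4 * D * H ^ 2)%N by rewrite -ltz_nat v'E ltz_pmod.
have [h1 h2] := hQ u' v' hu hv.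
by split; [apply: le_trans h1|apply: le_trans h2]; rewrite ler_nat;
  apply: leq_sum => k _; rewrite rowE.
Qed.

(** * Lines and curves in the pattern *)

Lemma divz_uniq (z n d : int) : d * n <= z -> z < d * (n + 1) -> (z %/ d)%Z = n.
Proof.
move=> z1 z2; have d0 : 0 < d by lia.
have -> : z = n * d + (z - n * d) by ring.
rewrite divzMDl ?gt_eqF // divz_small ?addr0 // gtz0_abs //; lia.
Qed.

Lemma divz_floor (R : realType) (D : nat) (y : R) :
  (0 < D)%N -> (Num.floor (D%:R * y) %/ D)%Z = Num.floor y.
Proof.
move=> D0; have DR : 0 < D%:R :> R by rewrite ltr0n.
set m := Num.floor _; have /andP[h1 h2] := floor_itv (D%:R * y).
symmetry; apply: floor_def.
have hm : m = (m %/ D)%Z * D + (m %% D)%Z by exact: divz_eq.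
have r0 : 0 <= (m %% D)%Z by apply: modz_ge0; lia.
have r1 : (m %% D)%Z < D by apply: ltz_pmod; lia.
have l1 : (m %/ D)%Z * D <= m by lia.
have l2 : m + 1 <= ((m %/ D)%Z + 1) * D by lia.
rewrite -(ler_pM2l DR) -(ltr_pM2l DR _ (_ + _)%:~R); apply/andP; split.
  by apply: le_trans h1; rewrite mulrC -[D%:R]/(D%:~R) -intrM ler_int.
by apply: lt_le_trans h2 _; rewrite [leRHS]mulrC -[D%:R]/(D%:~R) -intrM ler_int.
Qed.

(* [4 * D * H] is the resolution at which lines are rounded. *)
Definition line_sparse (R : realType) (D H : nat) (K : R)
    (Q : nat -> nat -> bool) : Prop :=
  forall u v : int,
    (\sum_(k < H) Q k `|(((u * H + v * k%:Z) %/ (4 * D * H)%N)%Z %% H)%Z|%N)%N%:R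
      <= K.

(* The sub-cells, in a cell cut into [D] rows, off the first and the last row: a
   curve meeting one of them passes through the same cell as any line within
   [1 / D] of it. *)
Definition inner (D : nat) (n : int) : bool := (0 < (n %% D)%Z < D%:Z - 1).

(* Rounding the line costs [1 / (2 D)], and so does its distance to [y]. *)
Lemma line_sparse_perturb (R : realType) (D H : nat) (K : R)
    (Q : nat -> nat -> bool) (y : nat -> R) (a c : R) :
  (0 < D)%N -> (0 < H)%N -> line_sparse R D H K Q ->
  (forall k, (k < H)%N -> `|y k - (a + c * k%:R)| <= (2 * D%:R)^-1) ->
  (\sum_(k < H) (Q k `|(Num.floor (y k) %% H)%Z|%N &&
                 inner D (Num.floor (D%:R * y k))))%N%:R <= K.
Proof.
move=> D0 H0 hQ hy.
have DR : 0 < D%:R :> R by rewrite ltr0n.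
have HR : 0 < H%:R :> R by rewrite ltr0n.
pose u := Num.floor (4 * D%:R * a); pose v := Num.floor (4 * D%:R * H%:R * c).
apply: le_trans (hQ u v); rewrite ler_nat; apply: leq_sum => k _.
have [hin|] := boolP (inner D _); last by rewrite andbF.
rewrite andbT; suff -> : Num.floor (y k) =
  ((u * H + v * k%:Z) %/ (4 * D * H)%N)%Z by [].
have /andP[n1 n2] := hin.
have [m1 m2] : D%:R * (Num.floor (y k))%:~R + 1 <= D%:R * y k /\
               D%:R * y k < D%:R * (Num.floor (y k))%:~R + D%:R - 1.
  have /andP[h1 h2] := floor_itv (D%:R * y k).
  set m := Num.floor (D%:R * y k) in h1 h2 n1 n2.
  have -> : Num.floor (y k) = (m %/ D)%Z by rewrite divz_floor.
  have hm : m = (m %/ D)%Z * D + (m %% D)%Z by exact: divz_eq.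
  have l1 : D%:Z * (m %/ D)%Z + 1 <= m by lia.
  have l2 : m + 1 <= D%:Z * (m %/ D)%Z + D - 1 by lia.
  split.
    apply: le_trans h1; rewrite -[D%:R]/(D%:~R) -intrM.
    by rewrite -(intrD _ _ 1) ler_int.
  apply: lt_le_trans h2 _; rewrite -[D%:R]/(D%:~R) -intrM.
  by rewrite -(intrD _ _ D) -(intrB _ _ 1) ler_int.
set n := Num.floor (y k) in m1 m2 *.
have /andP[u1 u2] := floor_itv (4 * D%:R * a); rewrite -/u in u1 u2.
have /andP[v1 v2] := floor_itv (4 * D%:R * H%:R * c); rewrite -/v in v1 v2.
have kH : k%:R + 1 <= H%:R :> R by rewrite natr1 ler_nat.
have k0 : 0 <= k%:R :> R by [].
have := hy k (ltn_ord k).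
rewrite ler_norml => /andP[d1 d2].
have D2 : D%:R * (2 * D%:R)^-1 = 1 / 2 :> R by field; rewrite gt_eqF.
have e1 : - (1 / 2) <= D%:R * y k - D%:R * (a + c * k%:R).
  by rewrite -mulrBr -D2 -mulrN ler_wpM2l // ltW.
have e2 : D%:R * y k - D%:R * (a + c * k%:R) <= 1 / 2.
  by rewrite -mulrBr -D2 ler_wpM2l // ltW.
rewrite intrD in u2; rewrite intrD in v2.
have w1 : v%:~R * k%:R <= 4 * D%:R * H%:R * c * k%:R :> R by rewrite ler_wpM2r.
have w2 : 4 * D%:R * H%:R * c * k%:R <= v%:~R * k%:R + k%:R :> R.
  by rewrite -[X in _ + X]mul1r -mulrDl ler_wpM2r // ltW.
have t1 : u%:~R * H%:R <= 4 * D%:R * a * H%:R :> R by rewrite ler_wpM2r // ltW.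
have t2 : 4 * D%:R * a * H%:R <= u%:~R * H%:R + H%:R :> R.
  by rewrite -[X in _ + X]mul1r -mulrDl ler_wpM2r // ltW.
set z := u * H + v * k%:Z.
have zE : z%:~R = u%:~R * H%:R + v%:~R * k%:R :> R by rewrite intrD !intrM.
have H4 : 0 <= 4 * H%:R :> R by lra.
have z1 : (4 * D * H)%N%:R * n%:~R < z%:~R :> R.
  have f1 : D%:R * n%:~R + 1 / 2 <= D%:R * (a + c * k%:R) by lra.
  have := ler_wpM2l H4 f1; rewrite zE !natrM; lra.
have z2 : z%:~R < (4 * D * H)%N%:R * (n + 1)%:~R :> R.
  have f1 : D%:R * (a + c * k%:R) <= D%:R * n%:~R + D%:R - 1 / 2 by lra.
  have := ler_wpM2l H4 f1; rewrite zE !natrM intrD; lra.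
move: z1 z2; rewrite -[(_ * _)%N%:R]/((4 * D * H)%N%:~R) -!intrM !ltr_int.
by move=> z1 z2; symmetry; apply: divz_uniq; rewrite ?(ltW z1).
Qed.

(** Convexity cleared of denominators, so that coinciding points need no exception. *)
Definition cvx (R : realType) (g : R -> R) : Prop := forall x y z,
  x <= y -> y <= z -> (z - x) * g y <= (z - y) * g x + (y - x) * g z.

(** The function lives on the whole line, so that a slope is available to the left of the first
    window as well. *)
Definition lip1_curve (R : realType) (g : R -> R) : Prop :=
  (forall x y, `|g x - g y| <= `|x - y|) /\ (cvx R g \/ cvx R (fun x => - g x)).

Definition slope (R : realType) (h : R) (g : R -> R) (x : R) : R :=
  (g (x + h) - g x) / h.

Lemma cvx_slope_le (R : realType) (g : R -> R) (h x : R) :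
  0 < h -> cvx R g -> slope R h g (x - h) <= slope R h g x.
Proof.
move=> h0 hg; rewrite /slope ler_pM2r ?invr_gt0 // subrK.
have := hg (x - h) x (x + h).
have -> : x + h - (x - h) = 2 * h by ring.
have -> : x + h - x = h by ring.
have -> : x - (x - h) = h by ring.
move=> /(_ _ _)/wrap[]; [lra|lra|].
rewrite -mulrDr [2 * h]mulrC -mulrA ler_pM2l //; lra.
Qed.

(** On [[x0, x0 + h]] a convex graph lies below its chord and above the prolonged chord of the
    preceding interval; these two lines differ by at most [h] times the slope jump. *)
Lemma cvx_chord (R : realType) (g : R -> R) (h x0 x : R) :
  0 < h -> x0 <= x <= x0 + h -> cvx R g ->
  `|g x - (g x0 + slope R h g x0 * (x - x0))| <=
    h * (slope R h g x0 - slope R h g (x0 - h)).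
Proof.
move=> h0 /andP[x1 x2] hg.
have hs := cvx_slope_le R g h x0 h0 hg.
set s := slope R h g x0 in hs *; set s' := slope R h g (x0 - h) in hs *.
have sE : h * s = g (x0 + h) - g x0 by rewrite mulrC divfK ?gt_eqF.
have s'E : h * s' = g x0 - g (x0 - h).
  by rewrite mulrC divfK ?gt_eqF // subrK.
have up := hg _ _ _ x1 x2.
have lo := hg (x0 - h) x0 x _ x1.
have {}lo := lo ltac:(lra).
rewrite ler_norml; apply/andP; split.
  have t1 : h * g x >= h * (g x0 + s' * (x - x0)).
    have -> : h * (g x0 + s' * (x - x0)) = h * g x0 + (h * s') * (x - x0) by ring.
    rewrite s'E; nra.
  rewrite ler_pM2l // in t1; nra.
have : h * g x <= h * (g x0 + s * (x - x0)).
  have -> : h * (g x0 + s * (x - x0)) = h * g x0 + (h * s) * (x - x0) by ring.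
  rewrite sE; nra.
rewrite ler_pM2l // => t2.
apply: (@le_trans _ _ 0); first lra.
by rewrite mulr_ge0 ?subr_ge0 // ltW.
Qed.

Lemma slopeN (R : realType) (g : R -> R) (h x : R) :
  slope R h (fun x => - g x) x = - slope R h g x.
Proof. rewrite /slope; ring. Qed.

Lemma lip1_chord (R : realType) (g : R -> R) (h x0 x : R) :
  0 < h -> x0 <= x <= x0 + h -> lip1_curve R g ->
  `|g x - (g x0 + slope R h g x0 * (x - x0))| <=
    h * `|slope R h g x0 - slope R h g (x0 - h)|.
Proof.
move=> h0 hx [_ [hg|hg]].
  apply: le_trans (cvx_chord R g h x0 x h0 hx hg) _.
  by rewrite ler_pM2l // ler_norm.
have := cvx_chord R _ h x0 x h0 hx hg; rewrite !slopeN => hle.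
have -> : g x - (g x0 + slope R h g x0 * (x - x0)) =
   - (- g x - (- g x0 + - slope R h g x0 * (x - x0))) by ring.
rewrite normrN; apply: le_trans hle _.
by rewrite ler_pM2l // -opprD -[in leRHS]normrN ler_norm.
Qed.

Lemma lip1_slope (R : realType) (g : R -> R) (h x : R) :
  0 < h -> lip1_curve R g -> `|slope R h g x| <= 1.
Proof.
move=> h0 [hg _]; rewrite /slope normrM normfV (gtr0_norm h0).
rewrite ler_pdivrMr // mul1r; apply: le_trans (hg _ _) _.
by rewrite addrAC subrr add0r gtr0_norm.
Qed.

(** The chord slopes are monotone, so the jumps telescope, and all slopes lie in [[-1, 1]]. *)
Lemma lip1_total_slope_variation (R : realType) (g : R -> R) (W : nat) :
  (0 < W)%N -> lip1_curve R g ->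
  \sum_(j < W) `|slope R W%:R^-1 g (j%:R / W%:R)
                 - slope R W%:R^-1 g (j%:R / W%:R - W%:R^-1)| <= 2.
Proof.
move=> W0 hg; have WR : 0 < W%:R^-1 :> R by rewrite invr_gt0 ltr0n.
pose s (j : nat) := slope R W%:R^-1 g ((j%:R - 1) / W%:R).
have sE (j : nat) : slope R W%:R^-1 g (j%:R / W%:R - W%:R^-1) = s j.
  by rewrite /s mulrBl mul1r.
have sE' (j : nat) : slope R W%:R^-1 g (j%:R / W%:R) = s j.+1.
  by rewrite /s -natr1 addrK.
have s1 j : `|s j| <= 1 by exact: lip1_slope.
have tel : \sum_(j < W) (s j.+1 - s j) = s W - s 0%N.
  by rewrite -(big_mkord predT (fun j => s j.+1 - s j)) telescope_sumr.
have [hc|hc] := hg.2.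
  rewrite (eq_bigr (fun j : 'I_W => s j.+1 - s j)); last first.
    move=> j _; rewrite sE sE' ger0_norm // subr_ge0 -sE' -sE.
    exact: cvx_slope_le.
  by rewrite tel; have := s1 W; have := s1 0%N; rewrite !ler_norml; lra.
rewrite (eq_bigr (fun j : 'I_W => - (s j.+1 - s j))); last first.
  move=> j _; rewrite sE sE' ler0_norm // subr_le0 -sE' -sE.
  have := cvx_slope_le R _ _ (j%:R / W%:R) WR hc.
  by rewrite !slopeN lerN2.
by rewrite sumrN tel; have := s1 W; have := s1 0%N; rewrite !ler_norml; lra.
Qed.

(* Of three mixed blocks, the middle one would lie between two points of [p]. *)
Lemma few_mixed_blocks (P W : nat) (p : nat -> bool) :
  (forall a b c, (a <= b <= c)%N -> p a -> p c -> p b) ->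
  (\sum_(j < W) [exists i : 'I_P, exists i' : 'I_P,
                   p (j * P + i) != p (j * P + i')] <= 2)%N.
Proof.
move=> hp; pose M := [pred j : 'I_W | [exists i : 'I_P, exists i' : 'I_P,
  p (j * P + i)%N != p (j * P + i')%N]].
rewrite -[X in (X <= _)%N](_ : #|M| = _); last by rewrite -sum1_card big_mkcond.
have [j0 Mj0|M0] := pickP M; last by rewrite (eq_card0 M0).
have hM j : M j -> (exists2 i, i < P & p (j * P + i))%N /\
                   (exists2 i, i < P & ~~ p (j * P + i))%N.
  move=> /existsP[i /existsP[i']].
  case E : (p (j * P + i)%N); case E' : (p (j * P + i')%N) => // _.
    by split; [exists i|exists i'; rewrite ?E'].
  by split; [exists i'|exists i; rewrite ?E].
have [a Ma amin] := arg_minnP (@nat_of_ord W) Mj0.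
have [c Mc cmax] := arg_maxnP (@nat_of_ord W) Mj0.
apply: leq_trans (_ : #|[set a; c]%SET| <= _)%N; last by rewrite cards2; case: eqP.
apply/subset_leq_card/fintype.subsetP => j Mj; rewrite !inE -!val_eqE /=.
have ja := amin j Mj; have jc := cmax j Mj.
have [[ia ia1 pa] _] := hM a Ma; have [[ic ic1 pc] _] := hM c Mc.
have [_ [i i1 np]] := hM j Mj.
apply: contraNT np => /norP[n1 n2].
have l1 : (a.+1 * P <= j * P)%N by rewrite leq_mul2r; lia.
have l2 : (j.+1 * P <= c * P)%N by rewrite leq_mul2r; lia.
apply: hp pa pc; lia.
Qed.

(** A fixed offset [e] leaves one sample in each pattern column [k]. The small jump keeps these
    samples, in units of pattern cells, within [1 / (2 D)] of the chord, hence of a line. *)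
Lemma linear_window_hits (R : realType) (D H W T j e : nat) (K : R)
    (Q : nat -> nat -> bool) (g : R -> R) :
  (0 < D)%N -> (0 < H)%N -> (0 < W)%N -> (0 < T)%N -> (e < T)%N ->
  line_sparse R D H K Q -> lip1_curve R g ->
  H%:R * `|slope R W%:R^-1 g (j%:R / W%:R)
           - slope R W%:R^-1 g (j%:R / W%:R - W%:R^-1)| <= (2 * D%:R)^-1 ->
  forall y : nat -> R,
  (forall k, y k = (W * H)%N%:R *
    g ((j * (H * T) + (k * T + e))%N%:R / (W * (H * T))%N%:R)) ->
  (\sum_(k < H) (Q k `|(Num.floor (y k) %% H)%Z|%N &&
                 inner D (Num.floor (D%:R * y k))))%N%:R <= K.
Proof.
move=> D0 H0 W0 T0 eT hQ hg hD y yE.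
have HR : 0 < H%:R :> R by rewrite ltr0n.
have WR : 0 < W%:R :> R by rewrite ltr0n.
have TR : 0 < T%:R :> R by rewrite ltr0n.
set s := slope R W%:R^-1 g (j%:R / W%:R) in hD.
apply: (line_sparse_perturb R D H K Q y
  (W%:R * H%:R * g (j%:R / W%:R) + s * (e%:R / T%:R)) s D0 H0 hQ) => k kH.
apply: le_trans hD.
have xE : (j * (H * T) + (k * T + e))%N%:R / (W * (H * T))%N%:R - j%:R / W%:R =
    (k%:R + e%:R / T%:R) / (W%:R * H%:R) :> R.
  by rewrite !(natrD, natrM); field; rewrite !gt_eqF.
set x := _ / (W * (H * T))%N%:R in xE.
have [t0 t1] : 0 <= e%:R / T%:R :> R /\ e%:R / T%:R <= 1 :> R.
  by rewrite divr_ge0 // ler_pdivrMr // mul1r ler_nat ltnW.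
have k1 : k%:R + 1 <= H%:R :> R by rewrite natr1 ler_nat.
have k0 : 0 <= k%:R :> R by [].
have hx : j%:R / W%:R <= x <= j%:R / W%:R + W%:R^-1.
  have -> : x = j%:R / W%:R + (k%:R + e%:R / T%:R) / (W%:R * H%:R).
    by rewrite -xE addrC subrK.
  rewrite lerDl lerD2l divr_ge0 ?mulr_ge0 ?addr_ge0 ?(ltW WR) ?(ltW HR) //=.
  rewrite ler_pdivrMr ?mulr_gt0 // mulKf ?gt_eqF //; lra.
have W1 : 0 < W%:R^-1 :> R by rewrite invr_gt0.
have := lip1_chord R g W%:R^-1 (j%:R / W%:R) x W1 hx hg.
rewrite -/s xE => hc.
have -> : y k - (W%:R * H%:R * g (j%:R / W%:R) + s * (e%:R / T%:R) + s * k%:R) =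
   W%:R * H%:R * (g x - (g (j%:R / W%:R) +
      s * ((k%:R + e%:R / T%:R) / (W%:R * H%:R)))).
  by rewrite yE -/x natrM; field; rewrite !gt_eqF.
have WH : 0 < W%:R * H%:R :> R by rewrite mulr_gt0.
rewrite normrM (gtr0_norm WH).
apply: le_trans (ler_wpM2l (ltW WH) hc) _.
by rewrite mulrA -[W%:R * _ * _]mulrA [H%:R / _]mulrC mulrA mulfV ?gt_eqF // mul1r.
Qed.

(** * Samples of a curve before and after a refinement *)

Definition samples (R : realType) (L D : nat) (S : int -> int -> bool)
    (g : R -> R) : nat :=
  (\sum_(m < L * D)
    S (m %/ D)%N%:Z (Num.floor (L%:R * g (m%:R / (L * D)%N%:R)%R)%R))%N.

(* Each cell is cut into [V * V] windows holding a copy of the [H * H] pattern [Q],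
   whose cells are themselves cut into [D * D] sub-cells. *)
Definition refine (V H D : nat) (S : int -> int -> bool)
    (Q : nat -> nat -> bool) (X Y : int) : bool :=
  [&& S (X %/ (V * H * D)%N)%Z (Y %/ (V * H * D)%N)%Z,
      Q `|((X %/ D)%Z %% H)%Z|%N `|((Y %/ D)%Z %% H)%Z|%N,
      inner D X & inner D Y].

(** A window lies in one column of old cells; if no grid height separates its samples, they also
    share a row, hence a cell. The heights [0] to [L] suffice because [S] has no cell in other
    rows. *)
Lemma unmixed_samples (R : realType) (L P V j : nat) (S : int -> int -> bool)
    (G : nat -> R) :
  (0 < P)%N -> (0 < V)%N -> (forall x y, S x y -> 0 <= y < L%:Z) ->
  (forall (r : 'I_L.+1) (i i' : 'I_P),
     (G (j * P + i)%N < r%:R) = (G (j * P + i')%N < r%:R)) ->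
  forall i i', (i < P)%N -> (i' < P)%N ->
  S ((j * P + i) %/ (V * P))%N%:Z (Num.floor (G (j * P + i)%N)) ->
  S ((j * P + i') %/ (V * P))%N%:Z (Num.floor (G (j * P + i')%N)).
Proof.
move=> P0 V0 hS hm i i' iP i'P.
have dE k : (k < P)%N -> ((j * P + k) %/ (V * P) = j %/ V)%N.
  by move=> kP; rewrite [(V * P)%N]mulnC divnMA divnMDl // (divn_small kP) addn0.
rewrite !dE // => h; have /andP[c0 cL] := hS _ _ h.
suff <- : Num.floor (G (j * P + i)%N) = Num.floor (G (j * P + i')%N) by [].
set c := Num.floor _ in c0 cL *.
have /andP[h1 h2] := floor_itv (G (j * P + i)%N); rewrite -/c in h1 h2.
move: c c0 cL h1 h2 {h} => [c|//] _ cL h1 h2.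
have cL1 : (c < L.+1)%N by move: cL; rewrite ltz_nat => /ltnW.
have cL2 : (c.+1 < L.+1)%N by rewrite ltnS -ltz_nat.
have := hm (Ordinal cL1) (Ordinal iP) (Ordinal i'P).
have := hm (Ordinal cL2) (Ordinal iP) (Ordinal i'P).
rewrite /= => e2 e1; symmetry; apply: floor_def.
rewrite leNgt -[(Posz c)%:~R]/(c%:R) -e1 -leNgt h1 /=.
by move: h2; rewrite -[Posz c + 1]/(Posz (c + 1)) addn1 e2.
Qed.

(** A sublevel set of a convex function, or the complement of one of a concave function, is an
    interval, so only the windows containing its ends can be mixed. *)
Lemma lip1_few_mixed_windows (R : realType) (L W P : nat) (g : R -> R) (r : R) :
  (0 < L)%N -> lip1_curve R g ->
  forall p : nat -> bool,
  (forall m, p m = (L%:R * g (m%:R / (W * P)%N%:R) < r)) ->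
  (\sum_(j < W) [exists i : 'I_P, exists i' : 'I_P,
                   p (j * P + i)%N != p (j * P + i')%N] <= 2)%N.
Proof.
move=> L0 [_ hg] p pdef; have LR : 0 < L%:R :> R by rewrite ltr0n.
have hdiv (a b : nat) : (a <= b)%N ->
    a%:R / (W * P)%N%:R <= b%:R / (W * P)%N%:R :> R.
  by move=> ab; rewrite ler_wpM2r ?invr_ge0 // ler_nat.
have conv (h : R -> R) : cvx R h -> forall a b c : nat, (a <= b <= c)%N ->
    h (b%:R / (W * P)%N%:R) <=
      Num.max (h (a%:R / (W * P)%N%:R)) (h (c%:R / (W * P)%N%:R)).
  move=> hh a b c /andP[/hdiv ab /hdiv bc].
  move: ab bc (hh _ _ _ ab bc); set x := a%:R / _; set y := b%:R / _.
  set z := c%:R / _ => xy yz hb.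
  have [xz|xz] := eqVneq x z.
    have -> : y = x by apply/le_anti; rewrite xy xz yz.
    by rewrite le_max lexx.
  have xz' : 0 < z - x.
    by rewrite subr_gt0 lt_neqAle xz (le_trans xy).
  rewrite -(ler_pM2l xz'); apply: le_trans hb _.
  have hx : h x <= Num.max (h x) (h z) by rewrite le_max lexx.
  have hz : h z <= Num.max (h x) (h z) by rewrite le_max lexx orbT.
  have -> : z - x = (z - y) + (y - x) by ring.
  by rewrite [leRHS]mulrDl lerD // ler_wpM2l // subr_ge0.
have pE m : p m = (g (m%:R / (W * P)%N%:R) < r / L%:R).
  by rewrite pdef ltr_pdivlMr // mulrC.
case: hg => /conv hg.
  apply: few_mixed_blocks => a b c abc; rewrite !pE => pa pc.
  by apply: le_lt_trans (hg _ _ _ abc) _; rewrite gt_max pa.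
under eq_bigr => j _.
  rewrite (_ : [exists i, _] = [exists i : 'I_P, exists i' : 'I_P,
                   ~~ p (j * P + i)%N != ~~ p (j * P + i')%N]); last first.
    by apply: eq_existsb => i; apply: eq_existsb => i'; rewrite (inj_eq negb_inj).
  over.
apply: (few_mixed_blocks P W (fun m => ~~ p m)) => a b c abc.
rewrite !pE -!leNgt => pa pc; rewrite -lerN2; apply: le_trans (hg _ _ _ abc) _.
by rewrite ge_max !lerN2 pa.
Qed.

Section refine_samples.
Variables (R : realType) (L V H D0 D : nat) (K : R).
Variables (S : int -> int -> bool) (Q : nat -> nat -> bool) (g : R -> R).
Hypotheses (L0 : (0 < L)%N) (V0 : (0 < V)%N) (H0 : (0 < H)%N).
Hypotheses (D00 : (0 < D0)%N) (Dp : (0 < D)%N) (K0 : 0 <= K).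
Hypothesis hS : forall x y, S x y -> 0 <= y < L%:Z.
Hypothesis hQ : line_sparse R D0 H K Q.
Hypothesis hg : lip1_curve R g.

(** There are [W] windows across the square, [T] samples in a pattern column and [P] samples in a
    window. [f] and [f'] tell whether a sample lies in the old and in the new stage. *)
Let W := (L * V)%N.
Let T := (D0 * D)%N.
Let P := (H * T)%N.
Let x (m : nat) : R := m%:R / (W * P)%N%:R.
Let f m : bool := S (m %/ (V * P))%N%:Z (Num.floor (L%:R * g (x m))).
Let f' m : bool := refine V H D0 S Q (m %/ D)%N%:Z
  (Num.floor ((L * (V * H * D0))%N%:R * g (x m))).
Let jump j := `|slope R W%:R^-1 g (j%:R / W%:R)
  - slope R W%:R^-1 g (j%:R / W%:R - W%:R^-1)|.
Let bad j : bool := (2 * D0%:R)^-1 < H%:R * jump j.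
Let mixed j (r : nat) : bool := [exists i : 'I_P, exists i' : 'I_P,
  (L%:R * g (x (j * P + i)) < r%:R) != (L%:R * g (x (j * P + i')) < r%:R)].

Let W0 : (0 < W)%N. Proof. by rewrite muln_gt0 L0. Qed.
Let T0 : (0 < T)%N. Proof. by rewrite muln_gt0 D00. Qed.
Let P0 : (0 < P)%N. Proof. by rewrite muln_gt0 H0. Qed.

Let f'f m : f' m -> f m.
Proof.
case/and4P => h _ _ _; move: h; rewrite divz_nat -divnMA.
have -> : (D * (V * H * D0) = V * P)%N by rewrite /P /T; ring.
have -> : (L * (V * H * D0))%N%:R * g (x m) =
    (V * H * D0)%N%:R * (L%:R * g (x m)) by rewrite natrM; ring.
by rewrite divz_floor // !muln_gt0 V0 H0.
Qed.

Let f'Q j k e : (k < H)%N -> (e < T)%N -> f' (j * P + (k * T + e)) ->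
  forall y, y = (W * H)%N%:R * g (x (j * P + (k * T + e))) ->
  Q k `|(Num.floor y %% H)%Z|%N && inner D0 (Num.floor (D0%:R * y)).
Proof.
move=> kH eT /and4P[_ h2 _ h4] y ydef.
have yE : (L * (V * H * D0))%N%:R * g (x (j * P + (k * T + e))) = D0%:R * y.
  by rewrite ydef mulrA -natrM; congr (_%:R * _); rewrite /W; ring.
rewrite yE in h2 h4; rewrite h4 andbT; move: h2; rewrite divz_floor //.
rewrite divz_nat modz_nat -divnMA.
have -> : (j * P + (k * T + e) = (j * H + k) * (D * D0) + e)%N.
  by rewrite /P /T; ring.
rewrite divnMDl ?muln_gt0 ?Dp // divn_small; last by rewrite mulnC.
by rewrite addn0 modnMDl modn_small.
Qed.

(** A window neither bad nor mixed has all or none of its samples in [S]. If all, each of the [T]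
    offsets contributes at most [K] hits, and [K * T] is [K / H] times [P]. Every other window is
    charged all its [P] samples. *)
Let window j : (\sum_(i < P) f' (j * P + i))%N%:R <=
  K / H%:R * (\sum_(i < P) f (j * P + i))%N%:R
  + (P * (bad j + \sum_(r < L.+1) mixed j r))%N%:R.
Proof.
have HR : 0 < H%:R :> R by rewrite ltr0n.
have triv : (\sum_(i < P) f' (j * P + i) <= P)%N.
  rewrite -[leqRHS]card_ord -sum1_card; apply: leq_sum => i _; exact: leq_b1.
have K1 : 0 <= K / H%:R * (\sum_(i < P) f (j * P + i))%N%:R.
  by rewrite mulr_ge0 // divr_ge0.
have [bm|] := boolP (0 < bad j + \sum_(r < L.+1) mixed j r)%N.
  apply: le_trans (_ : P%:R <= _); first by rewrite ler_nat.
  apply: ler_wpDl => //; rewrite ler_nat; exact: leq_pmulr.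
rewrite -eqn0Ngt => /eqP bm; rewrite bm muln0 addr0.
move/eqP: bm; rewrite addn_eq0 sum_nat_eq0 eqb0 /bad -leNgt => /andP[hb hm].
have [[i0 fi0]|nf] := pselect (exists i : 'I_P, f (j * P + i)); last first.
  rewrite big1 // => i _; apply/eqP; rewrite eqb0; apply/negP => /f'f h.
  by apply: nf; exists i.
have allf (i : 'I_P) : f (j * P + i).
  apply: (unmixed_samples R L P V j S (fun m => L%:R * g (x m)) P0 V0 hS)
    (ltn_ord i0) (ltn_ord i) fi0.
  move=> r a b; move/forallP: hm => /(_ r); rewrite eqb0 negb_exists.
  by move=> /forallP /(_ a); rewrite negb_exists => /forallP /(_ b) /negPn/eqP.
have -> : (\sum_(i < P) f (j * P + i) = P)%N.
  by rewrite (eq_bigr (fun=> 1%N)) ?sum1_card ?card_ord // => i _; rewrite allf.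
rewrite natrM mulrA divfK ?gt_eqF //.
rewrite (sum_block H T (fun i => f' (j * P + i)%N)) exchange_big natr_sum.
rewrite mulrC [_ * _](_ : _ = \sum_(e < T) K); last first.
  by rewrite sumr_const card_ord mulr_natl.
apply: ler_sum => e _.
apply: le_trans (linear_window_hits R D0 H W T j e K Q g D00 H0 W0 T0
  (ltn_ord e) hQ hg hb _ (fun k => erefl _)).
rewrite ler_nat; apply: leq_sum => k _; case E : (f' _) => //.
by have := f'Q j k e (ltn_ord k) (ltn_ord e) E _ erefl; rewrite lt0b => ->.
Qed.

(** Markov's inequality: a bad window has a jump above [1 / (2 * D0 * H)], and the jumps add up to
    at most 2. *)
Let few_bad : (\sum_(j < W) bad j <= 4 * D0 * H)%N.
Proof.
have HR : 0 < H%:R :> R by rewrite ltr0n.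
have DR : 0 < 2 * D0%:R :> R by rewrite mulr_gt0 // ltr0n.
rewrite -(ler_nat R) natr_sum.
have {1}-> : (4 * D0 * H)%N%:R = 2 * D0%:R * H%:R * 2 :> R by rewrite !natrM; ring.
apply: le_trans (_ : 2 * D0%:R * H%:R * \sum_(j < W) jump j <= _); last first.
  by rewrite ler_wpM2l ?mulr_ge0 ?(ltW DR) // lip1_total_slope_variation.
rewrite mulr_sumr; apply: ler_sum => j _; rewrite /bad.
case: ltP => [h|_] /=.
  by rewrite -mulrA -ler_pdivrMl // mulr1 ltW.
by apply: mulr_ge0 => //; apply: normr_ge0.
Qed.

Let few_mixed : (\sum_(j < W) \sum_(r < L.+1) mixed j r <= 2 * L.+1)%N.
Proof.
rewrite exchange_big /= mulnC -[X in (_ <= X * _)%N]card_ord -sum_nat_const.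
apply: leq_sum => r _.
exact: (lip1_few_mixed_windows R L W P g r%:R L0 hg
  (fun m => L%:R * g (x m) < r%:R) (fun m => erefl)).
Qed.

Lemma samples_refine :
  (samples R (L * (V * H * D0)) D (refine V H D0 S Q) g)%:R <=
  K / H%:R * (samples R L (V * H * D0 * D) S g)%:R +
  (P * (4 * D0 * H + 2 * L.+1))%N%:R.
Proof.
have E1 : (L * (V * H * D0) * D = W * P)%N by rewrite /W /P /T; ring.
have E2 : (L * (V * H * D0 * D) = W * P)%N by rewrite /W /P /T; ring.
have E3 : (V * H * D0 * D = V * P)%N by rewrite /P /T; ring.
rewrite /samples E1 E2 E3.
rewrite (sum_block W P f') (sum_block W P f) natr_sum.
apply: (@le_trans _ _ (\sum_(j < W) (K / H%:R * (\sum_(i < P) f (j * P + i))%N%:R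
    + (P * (bad j + \sum_(r < L.+1) mixed j r))%N%:R))).
  by apply: ler_sum => j _; exact: window.
rewrite big_split /= -mulr_sumr -natr_sum lerD2l -natr_sum ler_nat -big_distrr /=.
by rewrite leq_mul2l big_split /= leq_add ?orbT.
Qed.

End refine_samples.

(** * Refining a stage *)

Definition cells (L : nat) (S : int -> int -> bool) : nat :=
  (\sum_(a < L) \sum_(b < L) S a%:Z b%:Z)%N.

(* All sampling rates [D] are needed: the next stages sample at finer scales. *)
Definition good (R : realType) (K : R) (L : nat) (S : int -> int -> bool) : Prop :=
  forall (D : nat) (g : R -> R), (0 < D)%N -> lip1_curve R g ->
    (samples R L D S g)%:R * L%:R <= K * (cells L S)%:R * D%:R.

Lemma sum_inner (D : nat) : (\sum_(d < D) inner D d%:Z = D - 2)%N.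
Proof.
case: D => [|[|D]]; first by rewrite big_ord0.
  by rewrite big_ord_recl big_ord0.
have inE (d : nat) : (d < D.+2)%N -> inner D.+2 d%:Z = (0 < d < D.+1)%N.
  by move=> hd; rewrite /inner modz_small; lia.
rewrite big_ord_recr big_ord_recl /= !inE // ltnn andbF /= add0n addn0.
rewrite subn2 /= -[RHS]card_ord -sum1_card; apply: eq_bigr => i _.
have hb : bump 0 i = i.+1 by [].
have iD : (i.+1 < D.+1)%N by rewrite ltnS.
by rewrite hb inE ?iD // ltnW.
Qed.

(** Each pair of an old column and a pattern column is taken by [V * (D - 2)] inner new columns: one
    pattern column in each of the [V] windows, less its two border columns. *)
Lemma sum_refine (L V H D : nat) (G : nat -> nat -> nat) :
  (0 < V)%N -> (0 < H)%N -> (0 < D)%N ->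
  (\sum_(X < L * (V * H * D)) G (X %/ (V * H * D)) ((X %/ D) %% H)
       * inner D X%:Z =
   V * (D - 2) * \sum_(A < L) \sum_(k < H) G A k)%N.
Proof.
move=> V0 H0 D0.
rewrite (sum_block L (V * H * D) (fun X => G (X %/ (V * H * D)) ((X %/ D) %% H)
       * inner D X%:Z)%N) big_distrr /=; apply: eq_bigr => A _.
rewrite (sum_block (V * H) D (fun j => G ((A * (V * H * D) + j) %/ (V * H * D))
  (((A * (V * H * D) + j) %/ D) %% H) * inner D (A * (V * H * D) + j)%N%:Z)%N).
transitivity (\sum_(i < V * H) G A (i %% H) * (D - 2))%N.
  apply: eq_bigr => i _; rewrite -sum_inner big_distrr /=.
  apply: eq_bigr => d _; congr (G _ _ * nat_of_bool _)%N.
  - rewrite divnMDl ?muln_gt0 ?V0 ?H0 // divn_small ?addn0 //.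
    apply: (@leq_trans (i * D + D)%N); first by rewrite ltn_add2l.
    by rewrite -mulSnr leq_mul2r ltn_ord orbT.
  - by rewrite mulnA addnA -mulnDl divnMDl // (divn_small (ltn_ord d)) addn0
      mulnA modnMDl.
  - by rewrite /inner !modz_nat mulnA addnA -mulnDl modnMDl.
rewrite -big_distrl /= (sum_block V H (fun i => G A (i %% H)%N)).
have -> : (\sum_(v < V) \sum_(k < H) G A ((v * H + k) %% H)
    = V * \sum_(k < H) G A k)%N.
  rewrite -[in RHS](card_ord V) -sum_nat_const; apply: eq_bigr => v _.
  by apply: eq_bigr => k _; rewrite modnMDl modn_small.
by rewrite mulnAC.
Qed.

Lemma cells_refine (L V H D : nat) S Q :
  (0 < V)%N -> (0 < H)%N -> (0 < D)%N ->
  (cells (L * (V * H * D)) (refine V H D S Q) =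
   cells L S * V ^ 2 * (\sum_(k < H) \sum_(r < H) Q k r) * (D - 2) ^ 2)%N.
Proof.
move=> V0 H0 D0.
pose G A k := (\sum_(B < L) \sum_(r < H) (S A%:Z B%:Z && Q k r))%N.
transitivity (\sum_(X < L * (V * H * D)) (V * (D - 2)
    * (G (X %/ (V * H * D)) ((X %/ D) %% H) * inner D X%:Z)))%N.
  apply: eq_bigr => X _; rewrite [RHS]mulnA.
  rewrite -(sum_refine L V H D (fun B r =>
    S (X %/ (V * H * D))%N%:Z B%:Z && Q ((X %/ D) %% H)%N r)) //.
  rewrite big_distrl /=; apply: eq_bigr => Y _.
  rewrite /refine !divz_nat !modz_nat !absz_nat.
  by case: (inner D X%:Z); case: (inner D Y%:Z); case: (S _ _); case: (Q _ _).
rewrite -big_distrr /= sum_refine //.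
have -> : (\sum_(A < L) \sum_(k < H) G A k =
    cells L S * \sum_(k < H) \sum_(r < H) Q k r)%N.
  rewrite /cells big_distrl /=; apply: eq_bigr => A _.
  rewrite big_distrr /=; apply: eq_bigr => k _.
  rewrite big_distrl /=; apply: eq_bigr => B _.
  by rewrite big_distrr /=; apply: eq_bigr => r _; rewrite mulnb.
by rewrite !expnS !expn0; ring.
Qed.

(** The pattern costs [3 * eps], the exceptional windows one more [eps]. The squared quotient
    compensates for the border sub-cells, which are dropped in both directions and so lower the
    number of cells. *)
Lemma good_refine (R : realType) (L V q b D0 : nat) (K eps : R) S Q :
  (0 < L)%N -> (0 < V)%N -> (0 < q)%N -> (0 < b)%N -> (2 < D0)%N ->
  1 <= K -> 0 < eps -> (0 < cells L S)%N ->
  (forall x y, S x y -> 0 <= y < L%:Z) ->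
  (L * q * (4 * D0 * (b * q) + 2 * L.+1))%N%:R <= eps * V%:R ->
  line_sparse R D0 (b * q) ((1 + 3 * eps) * b%:R) Q ->
  (\sum_(k < b * q) \sum_(r < b * q) Q k r = b * q * b)%N ->
  good R K L S ->
  good R ((1 + 4 * eps) * (D0%:R / (D0 - 2)%N%:R) ^+ 2 * K)
    (L * (V * (b * q) * D0)) (refine V (b * q) D0 S Q).
Proof.
move=> L0 V0 q0 b0 D02 K1 e0 cS hS hV hQ sQ hK D g Dp hg.
have D00 : (0 < D0)%N by apply: leq_trans D02.
have H0 : (0 < b * q)%N by rewrite muln_gt0 b0.
rewrite cells_refine // sQ.
have bR : 0 < b%:R :> R by rewrite ltr0n.
have VR : 0 < V%:R :> R by rewrite ltr0n.
have LR : 0 < L%:R :> R by rewrite ltr0n.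
have DR : 0 < D%:R :> R by rewrite ltr0n.
have D0R : 0 < D0%:R :> R by rewrite ltr0n.
have D0R' : 0 < (D0 - 2)%N%:R :> R by rewrite ltr0n subn_gt0.
have HR : 0 < (b * q)%N%:R :> R by rewrite ltr0n.
have c1 : 1 <= (cells L S)%:R :> R by rewrite ler1n.
have Kb0 : 0 <= (1 + 3 * eps) * b%:R.
  by rewrite mulr_ge0 ?(ltW bR) // addr_ge0 // mulr_ge0 // ltW.
have := samples_refine R L V (b * q) D0 D _ S Q g L0 V0 H0 D00 Dp Kb0 hS hQ hg.
have := hK (V * (b * q) * D0 * D)%N g.
rewrite !muln_gt0 V0 b0 q0 D00 Dp => /(_ isT hg).
set s := (samples R L _ S g)%:R; set s' := (samples R _ _ _ g)%:R.
set err := (4 * D0 * (b * q) + 2 * L.+1)%N in hV *.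
rewrite !natrM; set c := (cells L S)%:R in c1 * => h1 h2; rewrite !natrM in hV.
have -> : (1 + 4 * eps) * (D0%:R / (D0 - 2)%N%:R) ^+ 2 * K *
    (c * (V%:R * V%:R) * (b%:R * q%:R * b%:R) *
      ((D0 - 2)%N%:R * (D0 - 2)%N%:R)) * D%:R =
    (1 + 4 * eps) * D0%:R ^+ 2 * K * c * V%:R ^+ 2 * (b%:R * q%:R * b%:R) * D%:R.
  by field; rewrite gt_eqF.
have qR : 0 < q%:R :> R by rewrite ltr0n.
pose F := V%:R * (b%:R * q%:R) * D0%:R : R.
have F0 : 0 < F by rewrite !mulr_gt0.
apply: (@le_trans _ _ (((1 + 3 * eps) * b%:R / (b%:R * q%:R)) * F * (s * L%:R)
    + L%:R * F * (b%:R * q%:R * (D0%:R * D%:R) * err%:R))).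
  have := ler_wpM2r (mulr_ge0 (ltW LR) (ltW F0)) h2.
  by rewrite /F; lra.
have G0 : 0 <= (1 + 3 * eps) * b%:R / (b%:R * q%:R) * F.
  by rewrite mulr_ge0 ?(ltW F0) // divr_ge0 // mulr_ge0 ?ltW.
have t1 := ler_wpM2l G0 h1.
pose J := V%:R * (b%:R * q%:R) * (b%:R * D0%:R ^+ 2 * D%:R) : R.
have J0 : 0 < J by rewrite !mulr_gt0 ?exprn_gt0.
have t2 := ler_wpM2r (ltW J0) hV.
(* The error term is free of [K] and [c]; this bound absorbs it into the main term. *)
have Kc : 1 <= K * c by rewrite -[1]mulr1 ler_pM.
have t3 : eps * V%:R * J <= eps * V%:R * J * (K * c).
  by rewrite ler_peMr // !mulr_ge0 // ltW.
apply: (@le_trans _ _ ((1 + 3 * eps) * b%:R / (b%:R * q%:R) * F *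
     (K * c * (V%:R * (b%:R * q%:R) * D0%:R * D%:R)) + eps * V%:R * J * (K * c))).
  apply: lerD => //; apply: le_trans t3; apply: le_trans t2.
  by rewrite le_eqVlt; apply/orP; left; apply/eqP; rewrite /F /J; ring.
rewrite le_eqVlt; apply/orP; left; apply/eqP; rewrite /F /J; field.
by rewrite !gt_eqF.
Qed.

Definition transpose (S : int -> int -> bool) (x y : int) : bool := S y x.

Definition supported (L : nat) (S : int -> int -> bool) : Prop :=
  forall x y, S x y -> (0 <= x < L%:Z) /\ (0 <= y < L%:Z).

Lemma cells_transpose L S : cells L (transpose S) = cells L S.
Proof. by rewrite /cells exchange_big. Qed.

Lemma transpose_refine V H D S Q :
  transpose (refine V H D S Q) =2
    refine V H D (transpose S) (fun k r => Q r k).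
Proof.
by move=> x y; rewrite /transpose /refine; congr [&& _, _ & _]; rewrite andbC.
Qed.

Lemma eq_good (R : realType) (K : R) L S S' : S =2 S' -> good R K L S -> good R K L S'.
Proof.
move=> e h D g D0 hg; have := h D g D0 hg.
congr (_ * _ <= K * _%:R * _).
  by congr _%:R; apply: eq_bigr => m _; rewrite e.
by apply: eq_bigr => a _; apply: eq_bigr => b _; rewrite e.
Qed.

(** With [q = b ^ n], a scale of at most [b ^ (3 n + 3)] and a density of at most [1 / q] give the
    dimension [beta] under this inequality. A large [n] satisfies it because
    [3 * (2 - beta) < 1]. *)
Lemma exists_rounded_exponent (R : realType) (beta : R) : 5 / 3 < beta ->
  exists2 n : nat, (0 < n)%N & (3 * n%:R + 3) * (2 - beta) <= n%:R.
Proof.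
move=> hb; pose s := 2 - beta; have hs : 0 < 1 - 3 * s by rewrite /s; lra.
pose n := (Num.bound (3 * s / (1 - 3 * s))).+1.
exists n => //; have h : 3 * s / (1 - 3 * s) < n%:R.
  by apply: (lt_trans (unstable.ltr_bound _)); rewrite ltr_nat.
move: h; rewrite ltr_pdivrMr // => h; rewrite -/s; lra.
Qed.

(** With [k = m + 1], [expR x >= (x / k) ^+ k] has one power of [b] more than the polynomial. *)
Lemma expR_gt_polynomial (R : realType) (eps : R) (C m : nat) : 0 < eps ->
  exists b0 : nat, forall b : nat, (b0 <= b)%N ->
    (C * b ^ m)%N%:R * expR (- (eps * b%:R)) < 1.
Proof.
move=> e0; pose k := m.+1; have kR : 0 < k%:R :> R by rewrite ltr0n.
have [b0 hb0] : exists b0 : nat, C%:R * (k%:R / eps) ^+ k < b0%:R :> R.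
  by exists (Num.bound (C%:R * (k%:R / eps) ^+ k)); apply: archi_boundP;
    rewrite mulr_ge0 // exprn_ge0 // divr_ge0 // ltW.
exists (maxn 1 b0) => b; rewrite geq_max => /andP[b1 hb].
have bR : 0 < b%:R :> R by rewrite ltr0n.
rewrite expRN ltr_pdivrMr ?expR_gt0 // mul1r.
have ek : (eps * b%:R / k%:R) ^+ k <= expR (eps * b%:R).
  have -> : expR (eps * b%:R) = expR (eps * b%:R / k%:R) ^+ k.
    by rewrite -expRM_natl [k%:R * _]mulrC divfK ?gt_eqF.
  apply: lerXn2r; rewrite ?nnegrE ?expR_ge0 //.
    by rewrite divr_ge0 // mulr_ge0 // ltW.
  by apply: le_trans (expR_ge1Dx _); rewrite lerDr.
apply: lt_le_trans ek; rewrite natrM natrX !exprMn exprVn.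
have : C%:R * (k%:R / eps) ^+ k < b%:R.
  by apply: lt_le_trans hb0 _; rewrite ler_nat.
rewrite exprMn exprVn => h.
rewrite ltr_pdivlMr ?exprn_gt0 //.
have ek0 : 0 < eps ^+ k by rewrite exprn_gt0.
rewrite mulrA ltr_pdivrMr // in h.
have bm : 0 < b%:R ^+ m :> R by rewrite exprn_gt0.
move: h; rewrite -(ltr_pM2r bm) => h.
have -> : C%:R * b%:R ^+ m * k%:R ^+ k = C%:R * k%:R ^+ k * b%:R ^+ m :> R by ring.
by apply: lt_le_trans h _; rewrite [X in _ <= _ * X]exprS mulrCA mulrA.
Qed.

Lemma supported_preimage (L E : nat) (S S' : int -> int -> bool) :
  (0 < E)%N -> supported L S ->
  (forall x y, S' x y -> S (x %/ E)%Z (y %/ E)%Z) -> supported (L * E) S'.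
Proof.
move=> E0 hS h x y /h /hS [hx hy].
have aux (z : int) : 0 <= (z %/ E)%Z < L%:Z -> 0 <= z < (L * E)%N%:Z.
  move=> /andP[z0 zL]; have EZ : 0 < E%:Z by [].
  have r0 := modz_ge0 z (lt0r_neq0 EZ); have r1 := ltz_pmod z EZ.
  rewrite (divz_eq z E) PoszM; apply/andP; split.
    by rewrite addr_ge0 // mulr_ge0 // ltW.
  apply: (@lt_le_trans _ _ (((z %/ E)%Z + 1) * E)); first by rewrite mulrDl mul1r ltrD2l.
  by rewrite ler_pM2r // lezD1.
by split; apply: aux.
Qed.

(** The left side is the new scale. It is at most [b ^ 2 * q ^ 3] times a constant known from the
    previous stage, and one further factor [b] absorbs that constant. *)
Lemma stage_constants (n L D0 c b : nat) :
  (0 < b)%N -> (L ^ 2 * (4 * D0 + 2 * L.+1) * c * D0 <= b)%N ->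
  (L * (L * b ^ n * (4 * D0 * (b * b ^ n) + 2 * L.+1) * c * (b * b ^ n) * D0)
    <= b ^ (3 * n + 3))%N.
Proof.
move=> b0 hb; set q := (b ^ n)%N.
have q0 : (0 < q)%N by rewrite expn_gt0 b0.
have -> : (b ^ (3 * n + 3) = b * (q ^ 3 * b ^ 2))%N.
  by rewrite /q -expnM -expnD -expnS; congr (_ ^ _)%N; lia.
apply: (@leq_trans (L ^ 2 * (4 * D0 + 2 * L.+1) * c * D0 * (q ^ 3 * b ^ 2))); last first.
  by rewrite leq_mul2r hb orbT.
have -> : (L ^ 2 * (4 * D0 + 2 * L.+1) * c * D0 * (q ^ 3 * b ^ 2) =
  L * (L * q * ((4 * D0 + 2 * L.+1) * (b * q)) * c * (b * q) * D0))%N by ring.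
do ?[apply: leq_mul => //].
rewrite mulnDl leq_add2l leq_pmulr // muln_gt0 b0 //.
Qed.

Lemma cells_le L S : (cells L S <= L ^ 2)%N.
Proof.
apply: (@leq_trans (\sum_(a < L) \sum_(b < L) 1)).
  by apply: leq_sum => a _; apply: leq_sum => b _; exact: leq_b1.
by rewrite !sum_nat_const !card_ord muln1 -mulnn.
Qed.

(** The bound on the scale [X] gives [X ^ (2 - beta) <= q], so the density bound [M <= X ^ 2 / q]
    becomes [M <= X ^ beta]. *)
Lemma cells_le_powR (R : realType) (beta : R) (X q b n M : nat) :
  beta <= 2 -> (0 < X)%N -> (0 < b)%N -> (X <= b ^ (3 * n + 3))%N ->
  (3 * n%:R + 3) * (2 - beta) <= n%:R :> R -> q = (b ^ n)%N ->
  (M * q <= X ^ 2)%N -> M%:R <= X%:R `^ beta.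
Proof.
move=> hb X0 b0 hX hn -> hM.
have XR : 0 < X%:R :> R by rewrite ltr0n.
have bR : 0 < b%:R :> R by rewrite ltr0n.
have h1 : X%:R `^ (2 - beta) <= b%:R ^+ n :> R.
  apply: (@le_trans _ _ ((b%:R ^+ (3 * n + 3)) `^ (2 - beta))).
    apply: ge0_ler_powR; rewrite ?nnegrE ?subr_ge0 ?exprn_ge0 //.
    by rewrite -natrX ler_nat.
  rewrite -powR_mulrn ?(ltW bR) // -powRrM -powR_mulrn ?(ltW bR) //.
  apply: ler_powR; first by rewrite ler1n.
  by rewrite natrD natrM.
have p0 : 0 < X%:R `^ (2 - beta) :> R by rewrite powR_gt0.
rewrite -(ler_pM2r p0); apply: (@le_trans _ _ (M%:R * b%:R ^+ n)).
  by rewrite ler_wpM2l.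
rewrite -powRD; last by rewrite (gt_eqF XR) implybT.
rewrite addrC subrK powR_mulrn ?(ltW XR) // -!natrX -natrM ler_nat //.
Qed.

Lemma stage (R : realType) (beta K K' : R) (L N0 : nat) (S : int -> int -> bool) :
  5 / 3 < beta -> beta < 2 -> (0 < L)%N -> supported L S -> (0 < cells L S)%N ->
  1 <= K -> K < K' -> good R K L S -> good R K L (transpose S) ->
  exists (E : nat) (S' : int -> int -> bool),
    [/\ (0 < E)%N, (N0 <= L * E)%N, supported (L * E) S',
        forall x y, S' x y -> S (x %/ E)%Z (y %/ E)%Z &
        (0 < cells (L * E) S')%N] /\
    [/\ good R K' (L * E) S', good R K' (L * E) (transpose S') &
        (cells (L * E) S')%:R <= (L * E)%N%:R `^ beta].
Proof.
move=> hb1 hb2 L0 hS cS K1 KK' gS gS'.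
have K0 : 0 < K by apply: lt_le_trans K1.
have [n n0 hn] := exists_rounded_exponent R beta hb1.
(* For [eps <= 1] one has [(1 + 4 * eps) * (1 + eps) ^+ 2 <= 1 + 19 * eps]. *)
pose eps := Num.min 1 ((K' / K - 1) / 19).
have e0 : 0 < eps by rewrite lt_min ltr01 divr_gt0 // subr_gt0 ltr_pdivlMr // mul1r.
have e1 : eps <= 1 by rewrite ge_min lexx.
have eK : (1 + 19 * eps) * K <= K'.
  rewrite -ler_pdivlMr //; have h : eps <= (K' / K - 1) / 19.
    by rewrite /eps ge_min lexx orbT.
  clear -h; lra.
have [c c0 hc] : exists2 c : nat, (0 < c)%N & 1 <= eps * c%:R.
  exists (Num.bound eps^-1).+1 => //; rewrite mulrC -ler_pdivrMr // div1r.
  by apply: ltW; apply: (lt_trans (unstable.ltr_bound _)); rewrite ltr_nat.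
(* This makes [D0 / (D0 - 2)] equal to [1 + 1 / c], at most [1 + eps]. *)
pose D0 := (2 * c + 2)%N.
have D02 : (2 < D0)%N by rewrite /D0; lia.
have D00 : (0 < D0)%N by apply: leq_trans D02.
have hD0 : (1 + 4 * eps) * (D0%:R / (D0 - 2)%N%:R) ^+ 2 * K <= K'.
  apply: le_trans eK; rewrite ler_pM2r //.
  have cR : 0 < c%:R :> R by rewrite ltr0n.
  have -> : D0%:R / (D0 - 2)%N%:R = 1 + c%:R^-1 :> R.
    by rewrite /D0 addnK natrD natrM; field; rewrite gt_eqF.
  have c1 : c%:R^-1 <= eps by rewrite -[leLHS]div1r ler_pdivrMr.
  have c2 : 0 < c%:R^-1 :> R by rewrite invr_gt0.
  apply: (@le_trans _ _ ((1 + 4 * eps) * (1 + eps) ^+ 2)).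
    rewrite ler_pM2l; last by rewrite addr_gt0 // mulr_gt0.
    by apply: lerXn2r; rewrite ?nnegrE ?lerD2l // addr_ge0 // ltW.
  by rewrite expr2; clear -e0 e1; nra.
have e20 : 0 < eps ^+ 2 by rewrite exprn_gt0.
have [b0 hb0] := expR_gt_polynomial R (eps ^+ 2) (32 * D0 ^ 2) (3 * n + 3) e20.
(* The summands serve the union bound, the required size of the new scale and the constants of the
   previous stage. *)
pose b := (b0 + N0 + (L ^ 2 * (4 * D0 + 2 * L.+1) * c * D0)).+1.
have bp : (0 < b)%N by [].
have bb0 : (b0 <= b)%N by rewrite /b -!addnA -addnS leq_addr.
have bN0 : (N0 <= b)%N by rewrite /b -addnA addnCA -addnS leq_addr.
have bC : (L ^ 2 * (4 * D0 + 2 * L.+1) * c * D0 <= b)%N.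
  by rewrite /b -addnS addnC -addnA addSn; rewrite addnC -addnS; lia.
pose q := (b ^ n)%N; have q0 : (0 < q)%N by rewrite expn_gt0.
have {hb0 bb0}hE : (32 * D0 ^ 2 * (b * q) ^ 3)%N%:R * expR (- (eps ^+ 2 * b%:R)) < 1.
  have -> : ((b * q) ^ 3 = b ^ (3 * n + 3))%N.
    by rewrite /q -expnS -expnM; congr (_ ^ _)%N; ring.
  exact: hb0.
have heps : 0 < eps <= 1 by rewrite e0.
have [Q [sQ lQ]] := line_pattern R eps D0 b q heps D00 bp q0 hE.
have H0 : (0 < b * q)%N by rewrite muln_gt0 bp.
(* Large enough for the exceptional windows to cost a relative error of at most [eps], since
   [1 <= eps * c]. *)
pose V := (L * q * (4 * D0 * (b * q) + 2 * L.+1) * c)%N.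
have V0 : (0 < V)%N by rewrite !muln_gt0 L0 q0 c0 addn_gt0 !orbT.
have hV : (L * q * (4 * D0 * (b * q) + 2 * L.+1))%N%:R <= eps * V%:R.
  by rewrite /V [in leRHS]natrM mulrCA ler_peMr.
have VE : V = (L * q * (4 * D0 * (b * q) + 2 * L.+1) * c)%N by [].
have qE : q = (b ^ n)%N by [].
clearbody V q D0 b.
pose E := (V * (b * q) * D0)%N.
have E0 : (0 < E)%N by rewrite !muln_gt0 V0 bp q0.
have LE0 : (0 < L * E)%N by rewrite muln_gt0 L0.
have cE : cells (L * E) (refine V (b * q) D0 S Q) =
   (cells L S * V ^ 2 * (b * q * b) * (D0 - 2) ^ 2)%N.
  by rewrite cells_refine // sQ.
exists E, (refine V (b * q) D0 S Q); split; split => //.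
- apply: leq_trans bN0 _; rewrite /E.
  have -> : (L * (V * (b * q) * D0) = b * (L * V * q * D0))%N by ring.
  by rewrite leq_pmulr // !muln_gt0 L0 V0 q0.
- by apply: supported_preimage hS _ => // x y /and4P[].
- by move=> x y /and4P[].
- by rewrite cE !muln_gt0 cS V0 bp q0 !subn_gt0 D02.
- have h := good_refine R L V q b D0 K eps S Q L0 V0 q0 bp D02 K1 e0 cS
    (fun x y h => (hS x y h).2) hV (fun u v => (lQ u v).1) sQ gS.
  move=> D g Dp hg; apply: le_trans (h D g Dp hg) _.
  by rewrite ler_wpM2r // ler_wpM2r.
- apply: (eq_good _ _ _ _ _ (fun x y => esym (transpose_refine _ _ _ _ _ x y))).
  have sQ' : (\sum_(k < b * q) \sum_(r < b * q) Q r k = b * q * b)%N.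
    by rewrite exchange_big.
  have cS' : (0 < cells L (transpose S))%N by rewrite cells_transpose.
  have h := good_refine R L V q b D0 K eps (transpose S) (fun k r => Q r k)
    L0 V0 q0 bp D02 K1 e0 cS'
    (fun x y h => (hS y x h).1) hV (fun u v => (lQ u v).2) sQ' gS'.
  move=> D g Dp hg; apply: le_trans (h D g Dp hg) _.
  by rewrite ler_wpM2r // ler_wpM2r.
- apply: (cells_le_powR R beta (L * E) q b n) => //; first exact: ltW.
    by rewrite /E VE qE; exact: stage_constants.
  rewrite cE.
  apply: (@leq_trans (L ^ 2 * V ^ 2 * (b * q * b) * D0 ^ 2 * q)).
    by rewrite !leq_mul ?leq_exp2r ?leq_subr // cells_le.
  by rewrite /E; apply: eq_leq; ring.
Qed.

(** The constant [2 - 1 / (i + 1)] starts at 1, grows strictly, which leaves room for the loss of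
    each refinement, and stays below 2. The bound [i <= L] drives the cell size to zero. *)
Record stage_inv (R : realType) (beta : R) (i L : nat) (S : int -> int -> bool) :
  Prop := StageInv {
    stage_pos : (0 < L)%N;
    stage_large : (i <= L)%N;
    stage_supported : supported L S;
    stage_nonempty : (0 < cells L S)%N;
    stage_good : good R (2 - i.+1%:R^-1) L S;
    stage_good_transpose : good R (2 - i.+1%:R^-1) L (transpose S);
    stage_cells : (cells L S)%:R <= L%:R `^ beta }.

Lemma stage_init (R : realType) (beta : R) :
  stage_inv R beta 0 1 (fun x y => (x == 0) && (y == 0)).
Proof.
have c1 : cells 1 (fun x y => (x == 0) && (y == 0)) = 1%N.
  by rewrite /cells !big_ord1.
split; rewrite ?c1 //.
- by move=> x y /andP[/eqP -> /eqP ->].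
- move=> D g D0 _; rewrite c1 invr1 -[2]/(1 + 1) addrK !mul1r mulr1 ler_nat.
  rewrite /samples -[leqRHS]mul1n -[leqRHS]card_ord -sum1_card.
  by apply: leq_sum => m _; exact: leq_b1.
- move=> D g D0 _; rewrite cells_transpose c1 invr1 -[2]/(1 + 1) addrK !mul1r mulr1.
  rewrite ler_nat /samples -[leqRHS]mul1n -[leqRHS]card_ord -sum1_card.
  by apply: leq_sum => m _; exact: leq_b1.
- by rewrite powR1.
Qed.

Lemma stage_sequence (R : realType) (beta : R) : 5 / 3 < beta -> beta < 2 ->
  exists (L : nat -> nat) (S : nat -> int -> int -> bool) (E : nat -> nat),
    forall i, [/\ stage_inv R beta i (L i) (S i), (0 < E i)%N,
      L i.+1 = (L i * E i)%N &
      forall x y, S i.+1 x y -> S i (x %/ E i)%Z (y %/ E i)%Z].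
Proof.
move=> hb1 hb2.
pose T := {s : nat * nat * (int -> int -> bool) | stage_inv R beta s.1.1 s.1.2 s.2}.
pose rel (s t : T) := (sval t).1.1 = (sval s).1.1.+1 /\ exists E, [/\ (0 < E)%N,
  (sval t).1.2 = ((sval s).1.2 * E)%N &
  forall x y, (sval t).2 x y -> (sval s).2 (x %/ E)%Z (y %/ E)%Z].
pose s0 : T := exist _ (0%N, 1%N, fun x y => (x == 0) && (y == 0)) (stage_init R beta).
have [|s [s0E sS]] := @dependent_choice T rel _ s0.
  move=> [[[i L] S] inv]; apply: cid; have [L0 _ hS cS gS gS' _] := inv.
  rewrite /= in L0 hS cS gS gS'.
  have i0 (n : nat) : 0 < n.+1%:R :> R by rewrite ltr0n.
  have K1 : 1 <= 2 - i.+1%:R^-1 :> R.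
    by rewrite lerBrDr addrC -lerBrDr -[2]/(1 + 1) addrK invf_le1 ?ler1n.
  have KK : 2 - i.+1%:R^-1 < 2 - i.+2%:R^-1 :> R.
    by rewrite ltrD2l ltrN2 ltf_pV2 ?posrE // ltr_nat.
  have [E [S' [[E0 hN hS' hE cS'] [g1 g2 hc]]]] :=
    stage R beta _ _ L i.+1 S hb1 hb2 L0 hS cS K1 KK gS gS'.
  have hinv : stage_inv R beta i.+1 (L * E) S' by split => //; rewrite muln_gt0 L0.
  by exists (exist _ (i.+1, (L * E)%N, S') hinv); split=> //=; exists E.
have idx i : (sval (s i)).1.1 = i.
  by elim: i => [|i IH]; [rewrite s0E|rewrite (sS i).1 IH].
have [E hE] := choice (fun i => (sS i).2).
exists (fun i => (sval (s i)).1.2), (fun i => (sval (s i)).2), E => i.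
have [h1 h2 h3] := hE i; split => //.
by have := svalP (s i); rewrite idx.
Qed.

(** * Covering a convex curve by Lipschitz curves *)

Lemma lip1_curveN (R : realType) (g : R -> R) :
  lip1_curve R g -> lip1_curve R (fun x => - g x).
Proof.
move=> [h1 h2]; split=> [x y|]; first by rewrite -opprD normrN.
have e : (fun x => - - g x) = g by apply/funext => x; rewrite opprK.
by case: h2; [right|left]; rewrite // e.
Qed.

Lemma lip1_curve0 (R : realType) : lip1_curve R (fun=> 0).
Proof.
split=> [x y|]; first by rewrite subrr normr0.
by left=> x y z _ _; rewrite !mulr0 addr0.
Qed.

(** Minimizing a jointly convex function over one variable leaves a convex function of the other,
    and Lipschitz bounds survive infima. The minorant [m] keeps the infimum finite. *)
Lemma inf_lip1_curve (R : realType) (D : R -> Prop) (h : R -> R -> R) (m : R -> R) :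
  (exists u, D u) ->
  (forall u x, D u -> m x <= h u x) ->
  (forall u x y, D u -> h u x <= h u y + `|x - y|) ->
  (forall u v x y z, D u -> D v -> x <= y -> y <= z -> x < z ->
     exists2 s, D s & (z - x) * h s y <= (z - y) * h u x + (y - x) * h v z) ->
  exists2 g, lip1_curve R g &
    forall u x, D u -> (forall v, D v -> h u x <= h v x) -> g x = h u x.
Proof.
move=> [u0 Du0] hm hlip hcvx.
pose A x := [set h u x | u in D].
pose g x := inf (A x).
have lbA x : has_lbound (A x).
  by exists (m x) => _ [u Du <-]; exact: hm.
have A0 x : A x !=set0 by exists (h u0 x), u0.
have gle u x : D u -> g x <= h u x by move=> Du; apply: ge_inf => //; exists u.
have leg c x : (forall u, D u -> c <= h u x) -> c <= g x.
  by move=> hc; apply: lb_le_inf => // _ [u Du <-]; exact: hc.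
have glip x y : g x <= g y + `|x - y|.
  rewrite -lerBlDr; apply: (leg) => u Du; rewrite lerBlDr.
  by apply: le_trans (gle u x Du) _; exact: hlip.
exists g; last first.
  move=> u x Du hu; apply/le_anti; rewrite gle //=; exact: leg.
split=> [x y|].
  rewrite ler_norml; apply/andP; split.
    by rewrite lerNl opprB lerBlDl distrC; exact: glip.
  by rewrite lerBlDl; exact: glip.
left=> x y z xy yz.
have [xz|] := ltP x z; last first.
  move=> zx; have zy := le_trans zx xy; have yx := le_trans yz zx.
  have -> : y = x by apply/le_anti; rewrite xy yx.
  by rewrite subrr mul0r addr0.
rewrite -lerBlDr.
have [yz'|zy] := ltP y z; last first.
  have -> : y = z by apply/le_anti; rewrite yz zy.
  by rewrite !subrr mul0r.
have zy0 : 0 < z - y by rewrite subr_gt0.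
rewrite -ler_pdivrMl //; apply: (leg) => u Du; rewrite ler_pdivrMl //.
rewrite lerBlDr -lerBlDl.
have [xy'|yx] := ltP x y; last first.
  have -> : y = x by apply/le_anti; rewrite xy yx.
  by rewrite subrr mul0r subr_le0 ler_pM2l ?subr_gt0 // gle.
have yx0 : 0 < y - x by rewrite subr_gt0.
rewrite -ler_pdivrMl //; apply: (leg) => v Dv; rewrite ler_pdivrMl // lerBlDl.
have [s Ds hs] := hcvx u v x y z Du Dv xy yz xz.
by apply: le_trans hs; rewrite ler_pM2l ?subr_gt0 // gle.
Qed.

Lemma convex_function01 (R : realType) (f : R -> R) :
  convex_function (`[0, 1]%classic : set R) f ->
  forall u v a b, 0 <= u <= 1 -> 0 <= v <= 1 -> 0 <= a -> 0 <= b -> 0 < a + b ->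
  exists2 s, (0 <= s <= 1) /\ (a + b) * s = a * u + b * v &
    (a + b) * f s <= a * f u + b * f v.
Proof.
move=> hf u v a b hu hv a0 b0 ab.
have t0 : 0 <= a / (a + b) by rewrite divr_ge0 // ltW.
have t1 : a / (a + b) <= 1 by rewrite ler_pdivrMr // mul1r lerDl.
have := hf (Itv01 t0 t1) u v; rewrite !inE /= !in_itv /= => /(_ hu hv).
rewrite !convRE /= /unstable.onem => h.
exists (a / (a + b) * u + (1 - a / (a + b)) * v).
  split; last by field; rewrite gt_eqF.
  move: hu hv => /andP[u0 u1] /andP[v0 v1].
  have t1' : 0 <= 1 - a / (a + b) by rewrite subr_ge0.
  apply/andP; split; first by rewrite addr_ge0 // mulr_ge0.
  have : a / (a + b) * u <= a / (a + b) * 1 by rewrite ler_wpM2l.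
  have : (1 - a / (a + b)) * v <= (1 - a / (a + b)) * 1 by rewrite ler_wpM2l.
  lra.
rewrite -(ler_pM2l ab) in h; apply: le_trans h _.
by rewrite le_eqVlt; apply/orP; left; apply/eqP; field; rewrite gt_eqF.
Qed.

(* A point of the graph is seen from [g1], [g2] or [g3] according to whether the
   slopes of [f] there are at most 1 in absolute value, at least 1 on the right
   or at most -1 on the left. *)
Lemma convex_graph_cover (R : realType) (f : R -> R) :
  convex_function (`[0, 1]%classic : set R) f ->
  exists g1 g2 g3 : R -> R,
    [/\ lip1_curve R g1, lip1_curve R g2, lip1_curve R g3 &
    forall x, 0 <= x <= 1 -> [\/ g1 x = f x, g2 (f x) = x | g3 (f x) = x]].
Proof.
move=> hf; have cf := convex_function01 R f hf.
pose D (u : R) : Prop := 0 <= u <= 1.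
have D0 : D 0 by rewrite /D lexx ler01.
pose mid x := D x /\ forall z, D z -> f x <= f z + `|x - z|.
(* [g1] is the infimal convolution of [f] with the absolute value, which agrees with [f] exactly
   where [mid] holds. *)
have [g1 lg1 hg1] : exists2 g1, lip1_curve R g1 & forall x, mid x -> g1 x = f x.
  have [[x0 [Dx0 hx0]]|nomid] := pselect (exists x, mid x); last first.
    by exists (fun=> 0); [exact: lip1_curve0|move=> x mx; case: nomid; exists x].
  have [||||g lg hg] := inf_lip1_curve R D (fun u x => f u + `|x - u|)
      (fun x => f x0 - `|x0 - x|).
  - by exists 0.
  - move=> u x /hx0 h; rewrite lerBlDr; apply: le_trans h _.
    by rewrite -addrA lerD2l addrC; exact: ler_distD.
  - by move=> u x y _; rewrite -addrA lerD2l addrC; exact: ler_distD.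
  - move=> u v x y z Du Dv xy yz xz.
    have zx : 0 < z - x by rewrite subr_gt0.
    have zy : 0 <= z - y by rewrite subr_ge0.
    have yx : 0 <= y - x by rewrite subr_ge0.
    have zyx : z - y + (y - x) = z - x by rewrite addrA subrK.
    have := cf u v (z - y) (y - x) Du Dv zy yx.
    rewrite zyx => /(_ zx) [s [Ds sE] hs].
    exists s => //; rewrite !mulrDr addrACA; apply: lerD => //.
    rewrite -{1}(gtr0_norm zx) -{1}(ger0_norm zy) -{1}(ger0_norm yx) -!normrM.
    apply: le_trans (ler_normD _ _).
    rewrite le_eqVlt; apply/orP; left; apply/eqP; congr `|_|.
    by rewrite mulrBr sE; ring.
  exists g => // x [Dx hx]; rewrite (hg x x Dx) ?subrr ?normr0 ?addr0 //.
(* With [e = 1] the infimum follows the left branch of the graph as a function of the height, with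
   [e = -1] the reflected right branch. The penalty [Num.max 0 (f u - y)] makes it 1-Lipschitz in
   [y]. *)
have side (e : R) : e = 1 \/ e = -1 ->
    exists2 g, lip1_curve R g & forall x, D x ->
      (forall v, D v -> e * x <= e * v + Num.max 0 (f v - f x)) -> g (f x) = e * x.
  move=> he; have ee : e * e = 1 by case: he => ->; rewrite ?mulrNN mulr1.
  have [||||g lg hg] := inf_lip1_curve R D (fun u y => e * u + Num.max 0 (f u - y))
      (fun=> -1).
  - by exists 0.
  - move=> u x /andP[u0 u1]; apply: (@le_trans _ _ (e * u)).
      by case: he => ->; lra.
    by rewrite lerDl le_max lexx.
  - move=> u x y _; rewrite -addrA lerD2l ge_max; apply/andP; split.
      by rewrite addr_ge0 // le_max lexx.
    have h1 : f u - y <= Num.max 0 (f u - y) by rewrite le_max lexx orbT.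
    have h2 : y - x <= `|x - y| by rewrite distrC ler_norm.
    clear -h1 h2; lra.
  - move=> u v x y z Du Dv xy yz xz.
    have zx : 0 < z - x by rewrite subr_gt0.
    have zy : 0 <= z - y by rewrite subr_ge0.
    have yx : 0 <= y - x by rewrite subr_ge0.
    have zyx : z - y + (y - x) = z - x by rewrite addrA subrK.
    have := cf u v (z - y) (y - x) Du Dv zy yx.
    rewrite zyx => /(_ zx) [s [Ds sE] hs].
    exists s => //; rewrite !mulrDr addrACA.
    have -> : (z - y) * (e * u) + (y - x) * (e * v) = (z - x) * (e * s).
      by rewrite [RHS]mulrCA sE; ring.
    rewrite lerD2l.
    set mu := Num.max 0 (f u - x); set mv := Num.max 0 (f v - z).
    have mu0 : 0 <= mu by rewrite le_max lexx.
    have mv0 : 0 <= mv by rewrite le_max lexx.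
    have hmu : (z - y) * (f u - x) <= (z - y) * mu.
      by rewrite ler_wpM2l // le_max lexx orbT.
    have hmv : (y - x) * (f v - z) <= (y - x) * mv.
      by rewrite ler_wpM2l // le_max lexx orbT.
    rewrite mulrC -ler_pdivlMr // ge_max ler_pdivlMr // mul0r.
    rewrite addr_ge0 ?mulr_ge0 //= ler_pdivlMr //.
    clear -hs hmu hmv; lra.
  exists g => // x Dx hx; rewrite (hg x (f x) Dx) ?subrr ?maxxx ?addr0 //.
have [gr lgr hgr] := side (-1) (or_intror erefl).
have [gl lgl hgl] := side 1 (or_introl erefl).
exists g1, (fun y => - gr y), gl; split => //; first exact: lip1_curveN.
move=> x Dx.
have [mx|] := pselect (mid x); first by constructor 1; exact: hg1.
move=> nmx; have [z Dz hz] : exists2 z, D z & f z + `|x - z| < f x.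
  apply: contrapT => h; apply: nmx; split=> // z Dz; rewrite leNgt; apply/negP => hz.
  by apply: h; exists z.
(* If [z] is on the left, the chord from [z] to [x] has slope above 1, and by convexity so have the
   chords from [x] to the right. The other side is symmetric. *)
have [zx|zx|zx] := ltgtP z x.
- constructor 2; rewrite hgr ?mulN1r ?opprK // => v Dv; rewrite !mulN1r.
  have [vx|xv] := leP v x.
    by apply: ler_wpDr; rewrite ?lerN2 // le_max lexx.
  have [|||s [Ds sE] hs] := cf z v (v - x) (x - z) Dz Dv.
  - by rewrite subr_ge0 ltW.
  - by rewrite subr_ge0 ltW.
  - by rewrite addrA subrK subr_gt0 (lt_trans zx).
  rewrite addrA subrK in sE hs.
  have vz : 0 < v - z by rewrite subr_gt0 (lt_trans zx).
  have sx : s = x.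
    by apply: (mulfI (lt0r_neq0 vz)); rewrite sE; ring.
  rewrite sx in hs; rewrite ger0_norm ?subr_ge0 ?(ltW zx) // in hz.
  rewrite addrC -lerBlDr le_max; apply/orP; right.
  have xz0 : 0 < x - z by rewrite subr_gt0.
  rewrite -(ler_pM2l xz0).
  have h : (v - x) * (x - z) <= (v - x) * (f x - f z).
    by rewrite ler_wpM2l ?subr_ge0 ?(ltW xv) //; clear -hz; lra.
  clear -h hs; lra.
- constructor 3; rewrite hgl ?mul1r // => v Dv; rewrite !mul1r.
  have [xv|vx] := leP x v.
    by apply: ler_wpDr; rewrite // le_max lexx.
  have [|||s [Ds sE] hs] := cf v z (z - x) (x - v) Dv Dz.
  - by rewrite subr_ge0 ltW.
  - by rewrite subr_ge0 ltW.
  - by rewrite addrA subrK subr_gt0 (lt_trans vx).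
  rewrite addrA subrK in sE hs.
  have vz : 0 < z - v by rewrite subr_gt0 (lt_trans vx).
  have sx : s = x.
    by apply: (mulfI (lt0r_neq0 vz)); rewrite sE; ring.
  rewrite sx in hs; rewrite ltr0_norm ?subr_lt0 // in hz.
  rewrite addrC -lerBlDr le_max; apply/orP; right.
  have xz0 : 0 < z - x by rewrite subr_gt0.
  rewrite -(ler_pM2l xz0).
  have h : (x - v) * (z - x) <= (x - v) * (f x - f z).
    by rewrite ler_wpM2l ?subr_ge0 ?(ltW vx) //; clear -hz; lra.
  clear -h hs; lra.
- by move: hz; rewrite zx subrr normr0 addr0 ltxx.
Qed.

(** * Tubes and compactness *)

Lemma lip1_curve_shift (R : realType) (g : R -> R) (c : R) :
  lip1_curve R g -> lip1_curve R (fun x => g x + c).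
Proof.
move=> [h1 h2]; split=> [x y|].
  by rewrite opprD addrACA subrr addr0.
case: h2 => h; [left|right] => x y z xy yz; have := h x y z xy yz; lra.
Qed.

(** A cell whose corner is that close to the graph is met by one of [2 * n + 1] vertical translates
    of it by multiples of [1 / L]. Each translate, sampled once per column, meets at most [2 / L]
    times the number of cells, and [2 * n + 1 <= 7 * w * L]. *)
Lemma near_graph_cells (R : realType) (L : nat) (S : int -> int -> bool)
    (g : R -> R) (w : R) :
  (0 < L)%N -> lip1_curve R g -> good R 2 L S -> 1 <= w * L%:R ->
  (\sum_(a < L) \sum_(b < L)
     (S a%:Z b%:Z && `[< (`|b%:R / L%:R - g (a%:R / L%:R)| < 2 * w)%R >]))%N%:R
  <= 14 * w * (cells L S)%:R.
Proof.
move=> L0 lg hS hw; have LR : 0 < L%:R :> R by rewrite ltr0n.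
set W := w * L%:R in hw.
pose n := `|Num.floor (2 * W + 1)|%N.
have n0 : 0 <= Num.floor (2 * W + 1) by rewrite floor_ge0; lra.
have nE : n%:Z = Num.floor (2 * W + 1) by rewrite gez0_abs.
have n1 : n%:R <= 2 * W + 1.
  by have /andP[h _] := floor_itv (2 * W + 1); rewrite -nE in h.
pose B (a : nat) := Num.floor (L%:R * g (a%:R / L%:R)).
pose gt (t : nat) x := g x + (t%:Z - n%:Z)%:~R / L%:R.
have lgt t : lip1_curve R (gt t) by exact: lip1_curve_shift.
have sE t : samples R L 1 S (gt t) = (\sum_(a < L) S a%:Z (B a + (t%:Z - n%:Z))%R)%N.
  rewrite /samples muln1; apply: eq_bigr => a _; rewrite divn1 /gt mulrDr.
  by rewrite [L%:R * (_ / _)]mulrC divfK ?gt_eqF // floorDrz ?intr_int // intrKfloor.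
have hit (a b : nat) : `|b%:R / L%:R - g (a%:R / L%:R)| < 2 * w ->
    exists2 t, (t < 2 * n + 1)%N & b%:Z = B a + (t%:Z - n%:Z).
  move=> h.
  have h1 : `|b%:R - L%:R * g (a%:R / L%:R)| < 2 * W.
    have -> : b%:R - L%:R * g (a%:R / L%:R) = L%:R * (b%:R / L%:R - g (a%:R / L%:R)).
      by field; rewrite gt_eqF.
    by rewrite normrM gtr0_norm // /W mulrA [_ * L%:R]mulrC ltr_pM2l.
  have /andP[f1 f2] := floor_itv (L%:R * g (a%:R / L%:R)).
  rewrite -/(B a) intrD in f1 f2.
  move: h1; rewrite ltr_norml => /andP[l1 l2].
  have e1 : b%:Z - B a <= n%:Z.
    by rewrite nE floor_ge_int intrB; rewrite -[b%:Z%:~R]/(b%:R); lra.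
  have e2 : B a - b%:Z <= n%:Z.
    by rewrite nE floor_ge_int intrB; rewrite -[b%:Z%:~R]/(b%:R); lra.
  clear -e1 e2.
  by exists `|(b%:Z - B a + n%:Z)%R|%N; lia.
apply: (@le_trans _ _ (\sum_(t < 2 * n + 1) samples R L 1 S (gt t))%N%:R).
  rewrite ler_nat; under [X in (_ <= X)%N]eq_bigr => t _ do rewrite sE.
  rewrite [X in (_ <= X)%N]exchange_big /=.
  apply: leq_sum => a _.
  apply: (@leq_trans (\sum_(b < L) \sum_(t < 2 * n + 1)
      (S a%:Z (B a + (t%:Z - n%:Z))%R && (b%:Z == B a + (t%:Z - n%:Z))%R))%N).
    apply: leq_sum => b _; case Sab : (S a%:Z b%:Z) => //=.
    case: asboolP => // /hit [t ht bE].
    by rewrite (bigD1 (Ordinal ht)) //= -bE Sab eqxx.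
  rewrite exchange_big /=; apply: leq_sum => t _.
  set c := B a + _; case Sac : (S a%:Z c) => //=; last by rewrite big1.
  have [b0 hb0|hb] := pickP (fun b : 'I_L => b%:Z == c); last first.
    by rewrite big1 // => b _; rewrite hb.
  rewrite (bigD1 b0) //= big1 ?addn0 ?leq_b1 // => b bb0.
  apply/eqP; rewrite eqb0; apply: contraNN bb0 => /eqP bc.
  by rewrite -val_eqE -eqz_nat bc (eqP hb0).
rewrite natr_sum.
apply: (@le_trans _ _ (\sum_(t < 2 * n + 1) 2 * (cells L S)%:R / L%:R)).
  apply: ler_sum => t _; rewrite ler_pdivlMr //.
  by have := hS 1%N (gt t) isT (lgt t); rewrite mulr1.
rewrite sumr_const card_ord -[_ *+ (2 * n + 1)]mulr_natl natrD natrM.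
have -> : 14 * w * (cells L S)%:R = 7 * W * (2 * (cells L S)%:R / L%:R).
  by rewrite /W; field; rewrite gt_eqF.
by rewrite ler_wpM2r ?divr_ge0 ?mulr_ge0 //; clear -n1 hw; lra.
Qed.

(** The cells are closed, which makes the stages compact and puts the lower left corner of a cell
    into its stage. *)
Definition cell_union (R : realType) (L : nat) (S : int -> int -> bool) :
    set (R * R) :=
  [set p | exists a b : int, [/\ S a b, a%:~R <= L%:R * p.1 <= a%:~R + 1 &
                                 b%:~R <= L%:R * p.2 <= b%:~R + 1]].

Lemma cell_union_nested (R : realType) (L E : nat) (S S' : int -> int -> bool) :
  (0 < E)%N -> (forall x y, S' x y -> S (x %/ E)%Z (y %/ E)%Z) ->
  cell_union R (L * E) S' `<=` cell_union R L S.
Proof.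
move=> E0 h p [a [b [Sab ha hb]]]; exists (a %/ E)%Z, (b %/ E)%Z.
have ER : 0 < E%:R :> R by rewrite ltr0n.
have aux (z : int) (t : R) : z%:~R <= (L * E)%N%:R * t <= z%:~R + 1 ->
    (z %/ E)%Z%:~R <= L%:R * t <= (z %/ E)%Z%:~R + 1.
  move=> /andP[z1 z2].
  have EZ : 0 < E%:Z by [].
  have r0 := modz_ge0 z (lt0r_neq0 EZ); have r1 := ltz_pmod z EZ.
  have hz := divz_eq z E.
  have l1 : (z %/ E)%Z * E <= z by clear -hz r0; lia.
  have l2 : z + 1 <= ((z %/ E)%Z + 1) * E by clear -hz r1; lia.
  rewrite natrM mulrAC in z1 z2.
  rewrite -(ler_pM2r ER) -(ler_pM2r ER (L%:R * t)); apply/andP; split.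
    by apply: le_trans z1; rewrite -[E%:R]/(E%:~R) -intrM ler_int.
  apply: (le_trans z2); rewrite -(intrD _ z 1) -(intrD _ _ 1) -[E%:R]/(E%:~R).
  by rewrite -intrM ler_int.
by split; [exact: h|exact: aux|exact: aux].
Qed.

Lemma cell_union_compact (R : realType) (L : nat) (S : int -> int -> bool) :
  (0 < L)%N -> supported L S -> compact (cell_union R L S).
Proof.
move=> L0 hS; have LR : 0 < L%:R :> R by rewrite ltr0n.
pose box (ab : 'I_L * 'I_L) : set (R * R) :=
  `[ab.1%:R / L%:R, (ab.1%:R + 1) / L%:R] `*` `[ab.2%:R / L%:R, (ab.2%:R + 1) / L%:R].
pose I := [set ab : 'I_L * 'I_L | S ab.1%:Z ab.2%:Z].
have boxP ab (p : R * R) : box ab p <-> ab.1%:R <= L%:R * p.1 <= ab.1%:R + 1 /\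
    ab.2%:R <= L%:R * p.2 <= ab.2%:R + 1.
  rewrite /box /setX /= !in_itv /= !ler_pdivrMr // !ler_pdivlMr //.
  by rewrite ![_ * L%:R]mulrC.
have boxc ab : compact (box ab).
  by apply: compact_setX; exact: segment_compact.
have -> : cell_union R L S = \bigcup_(ab in I) box ab.
  apply/seteqP; split=> p.
    move=> [a [b [Sab ha hb]]]; have [/andP[a0 aL] /andP[b0 bL]] := hS a b Sab.
    move: a b a0 aL b0 bL Sab ha hb => [a|//] [b|//] _ aL _ bL Sab ha hb.
    by exists (Ordinal (aL : (a < L)%N), Ordinal (bL : (b < L)%N)) => //; apply/boxP.
  move=> [[a b] Sab /boxP [ha hb]].
  by exists a%:Z, b%:Z.
rewrite bigcup_fset_set; last exact: finite_finset.
apply: bigsetU_compact => ab _; exact: boxc.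
Qed.

Lemma edist2_ball_open (R : realType) (y : R * R) (w : R) :
  open [set x | edist2 x y < w].
Proof.
have [w0|w0] := leP w 0.
  rewrite (_ : [set x | _] = set0) ?open0 //; apply/seteqP; split=> // x /=.
  by move=> /lt_le_trans /(_ w0); rewrite ltNge sqrtr_ge0.
pose d (x : R * R) := (x.1 - y.1) ^+ 2 + (x.2 - y.2) ^+ 2.
have dE x : (Num.sqrt (d x) < w) = (d x < w ^+ 2).
  by rewrite -{1}(gtr0_norm w0) -sqrtr_sqr ltr_sqrt // exprn_gt0.
have -> : [set x | edist2 x y < w] = d @^-1` [set r | r < w ^+ 2].
  apply/seteqP; split=> x /=; rewrite /edist2 -/(d x).
    by rewrite dE.
  by rewrite dE.
have c1 : continuous (fun x : R * R => x.1 - y.1).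
  by move=> x; apply: cvgB; [exact: cvg_fst|exact: cvg_cst].
have c2 : continuous (fun x : R * R => x.2 - y.2).
  by move=> x; apply: cvgB; [exact: cvg_snd|exact: cvg_cst].
apply: open_comp; last exact: open_lt.
by move=> x _; apply: cvgD; rewrite expr2; apply: cvgM; (exact: c1 || exact: c2).
Qed.

Lemma convex_tube_open (R : realType) (w : R) (T : set (R * R)) :
  convex_tube w T -> open T.
Proof.
move=> [w0 [G _ ->]].
have -> : neighborhood2 w G = \bigcup_(y in G) [set x | edist2 x y < w].
  by apply/seteqP; split=> x [y Gy h]; exists y.
by apply: bigcup_open => y _; exact: edist2_ball_open.
Qed.

Lemma edist2_ge (R : realType) (x y : R * R) :
  `|x.1 - y.1| <= edist2 x y /\ `|x.2 - y.2| <= edist2 x y.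
Proof.
rewrite /edist2 -!sqrtr_sqr; split; rewrite ler_sqrt ?addr_ge0 ?sqr_ge0 //.
  by rewrite lerDl sqr_ge0.
by rewrite lerDr sqr_ge0.
Qed.

(** A corner in the tube is within [w], in each coordinate, of a point on one of three 1-Lipschitz
    curves, so within [2 * w] of that curve along its axis of values. Each curve accounts for a
    third of 42; those over the second axis use the transposed stage. *)
Lemma convex_tube_cells (R : realType) (L : nat) (S : int -> int -> bool)
    (w : R) (T : set (R * R)) :
  (0 < L)%N -> good R 2 L S -> good R 2 L (transpose S) -> convex_tube w T ->
  1 <= w * L%:R ->
  (\sum_(a < L) \sum_(b < L)
     (S a%:Z b%:Z && `[< T (a%:R / L%:R, b%:R / L%:R)%R >]))%N%:R
  <= 42 * w * (cells L S)%:R.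
Proof.
move=> L0 gS gS' [w0 [_ [f cf ->] ->]] hw.
have [g1 [g2 [g3 [l1 l2 l3 hg]]]] := convex_graph_cover R f cf.
pose near (g : R -> R) (a b : nat) : bool :=
  `[< `|b%:R / L%:R - g (a%:R / L%:R)| < 2 * w >].
have hit (a b : nat) : neighborhood2 w (graph01 f) (a%:R / L%:R, b%:R / L%:R) ->
    [|| near g1 a b, near g2 b a | near g3 b a].
  move=> [[x y] [/= hx ->] hd]; rewrite in_itv /= in hx.
  have [d1 d2] := edist2_ge R (a%:R / L%:R, b%:R / L%:R) (x, f x).
  move: {d1 d2} (le_lt_trans d1 hd) (le_lt_trans d2 hd) => /=.
  set u := a%:R / L%:R; set v := b%:R / L%:R => d1 d2.
  have aux (g : R -> R) (s s' t t' : R) : lip1_curve R g -> `|s - s'| < w ->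
      `|t - t'| < w -> g s' = t' -> `|t - g s| < 2 * w.
    move=> [lg _] hs ht gE.
    have -> : t - g s = (t - t') + (g s' - g s) by rewrite gE; ring.
    apply: le_lt_trans (ler_normD _ _) _.
    have := lg s' s; rewrite (distrC s'); clear -hs ht; lra.
  have [e|e|e] := hg x hx.
  - by apply/orP; left; apply/asboolP; exact: (aux g1 u x v (f x)).
  - apply/orP; right; apply/orP; left; apply/asboolP.
    exact: (aux g2 v (f x) u x).
  - apply/orP; right; apply/orP; right; apply/asboolP.
    exact: (aux g3 v (f x) u x).
have n1 := near_graph_cells R L S g1 w L0 l1 gS hw.
have n2 := near_graph_cells R L (transpose S) g2 w L0 l2 gS' hw.
have n3 := near_graph_cells R L (transpose S) g3 w L0 l3 gS' hw.
rewrite cells_transpose exchange_big in n2; rewrite cells_transpose exchange_big in n3.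
have -> : 42 * w * (cells L S)%:R = 14 * w * (cells L S)%:R +
  (14 * w * (cells L S)%:R + 14 * w * (cells L S)%:R) by ring.
apply: le_trans (lerD n1 (lerD n2 n3)).
rewrite -!natrD ler_nat -!big_split /=; apply: leq_sum => a _.
rewrite -!big_split /=; apply: leq_sum => b _.
rewrite /transpose; case: (S a%:Z b%:Z) => //=.
case: asboolP => // /hit; rewrite /near; by do 3!case: `[< _ >].
Qed.

(** The complement of [K n] together with the sets [T j], [j < n], is open and increases with [n];
    these unions cover the compact [K 0], so one of them does. *)
Lemma decreasing_compact_cover (R : realType) (K : nat -> set (R * R))
    (J : set nat) (T : nat -> set (R * R)) :
  (forall i, K i.+1 `<=` K i) -> (forall i, compact (K i)) ->
  (forall j, J j -> open (T j)) -> \bigcap_i K i `<=` \bigcup_(j in J) T j ->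
  exists n, K n `<=` \bigcup_(j in [set j | J j /\ (j < n)%N]) T j.
Proof.
move=> Kd Kc To hcov.
have Kle m n : (m <= n)%N -> K n `<=` K m.
  by move=> /subnK <-; elim: (n - m)%N => // k IH; apply: subset_trans (Kd _) IH.
pose U n := ~` K n `|` \bigcup_(j in [set j | J j /\ (j < n)%N]) T j.
have Uo n : open (U n).
  apply: openU; last by apply: bigcup_open => j [Jj _]; exact: To.
  by rewrite openC; apply: compact_closed => //; exact: norm_hausdorff.
have Ule m n : (m <= n)%N -> U m `<=` U n.
  move=> mn p [nK|[j [Jj jm] Tj]]; first by left => /(Kle _ _ mn).
  by right; exists j => //; split=> //; exact: leq_trans mn.
have cov p : K 0%N p -> exists i, U i p.
  move=> K0p; have [hp|] := pselect ((\bigcap_i K i) p).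
    have [j Jj Tj] := hcov p hp.
    by exists j.+1; right; exists j.
  by move=> /existsNP [i /not_implyP [_ nK]]; exists i; left.
have [n _ hn] : \forall n \near \oo, K 0%N `<=` U n.
  have /compact_near_coveringP := Kc 0%N; apply=> p /cov [i Uip].
  exists (U i, [set n | (i <= n)%N]); last first.
    by move=> [q n] /= [Uiq le_in]; exact: (Ule i n le_in).
  split=> /=; last by exists i.
  by apply: open_nbhs_nbhs; split; [exact: Uo|].
exists n => p Kp; have := hn n (leqnn n) p (Kle 0%N n (leq0n _) p Kp).
by case.
Qed.

(** Finitely many of the tubes already cover some stage. At a finer stage, a total width below
    [1 / 42] would let them contain fewer corners than there are cells. *)
Lemma stage_not_tube_null (R : realType) (beta : R) (L : nat -> nat)
    (S : nat -> int -> int -> bool) (E : nat -> nat) :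
  (forall i, [/\ stage_inv R beta i (L i) (S i), (0 < E i)%N,
      L i.+1 = (L i * E i)%N &
      forall x y, S i.+1 x y -> S i (x %/ E i)%Z (y %/ E i)%Z]) ->
  ~ convex_tube_null (\bigcap_i cell_union R (L i) (S i)).
Proof.
move=> hst; pose K i := cell_union R (L i) (S i).
have Kd i : K i.+1 `<=` K i.
  by have [_ E0 LE h] := hst i; rewrite /K LE; exact: cell_union_nested.
have Kle m n : (m <= n)%N -> K n `<=` K m.
  by move=> /subnK <-; elim: (n - m)%N => // k IH; apply: subset_trans (Kd _) IH.
have Kc i : compact (K i).
  by have [[L0 _ hS _ _ _ _] _ _ _] := hst i; exact: cell_union_compact.
have d0 : 0 < 42^-1 :> R by rewrite invr_gt0.
move=> /(_ _ d0) [J [T [w [hT hcov hw]]]].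
have [n hn] := decreasing_compact_cover R K J T Kd Kc
  (fun j Jj => convex_tube_open R _ _ (hT j Jj)) hcov.
have w0 j : J j -> 0 < w j by move=> /hT[].
(* As [i <= L i], the cells of stage [i] are no wider than any of the finitely many tubes. *)
pose i := (n + \sum_(j < n) Num.bound (w j)^-1)%N.
have [[L0 Li hS cS gS gS' _] _ _ _] := hst i.
have LR : 0 < (L i)%:R :> R by rewrite ltr0n.
have K2 : 2 - i.+1%:R^-1 <= 2 :> R by rewrite gerBl invr_ge0.
have g2 S' : good R (2 - i.+1%:R^-1) (L i) S' -> good R 2 (L i) S'.
  move=> h D g Dp lg; apply: le_trans (h D g Dp lg) _.
  by rewrite !ler_wpM2r.
have wL j : J j -> (j < n)%N -> 1 <= w j * (L i)%:R.
  move=> Jj jn; rewrite mulrC -ler_pdivrMr ?w0 // div1r.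
  apply: le_trans (ltW (unstable.ltr_bound _)) _; rewrite ler_nat.
  apply: leq_trans Li; rewrite /i (bigD1 (Ordinal jn)) //=.
  exact: leq_trans (leq_addr _ _) (leq_addl _ _).
have : (cells (L i) (S i))%:R <=
    \sum_(j < n | nat_of_ord j \in J) 42 * w j * (cells (L i) (S i))%:R.
  apply: (@le_trans _ _ (\sum_(j < n | nat_of_ord j \in J)
    (\sum_(a < L i) \sum_(b < L i)
     (S i a%:Z b%:Z && `[< T j (a%:R / (L i)%:R, b%:R / (L i)%:R)%R >]))%N%:R)).
    rewrite -natr_sum ler_nat exchange_big /=; apply: leq_sum => a _.
    rewrite exchange_big /=; apply: leq_sum => b _.
    case Sab : (S i a%:Z b%:Z) => //=.
    have Kp : K i (a%:R / (L i)%:R, b%:R / (L i)%:R).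
      exists a%:Z, b%:Z; rewrite Sab /= ![(L i)%:R * _]mulrC !divfK ?gt_eqF //.
      by split => //; rewrite lexx lerDl ler01.
    have [j /= [Jj jn] Tj] := hn _ (Kle n i (leq_addr _ _) _ Kp).
    rewrite (bigD1 (Ordinal jn)) /=; last exact: mem_set.
    by rewrite asboolT.
  apply: ler_sum => j /set_mem Jj.
  by apply: convex_tube_cells; [|exact: g2|exact: g2|exact: hT|exact: wL].
rewrite -mulr_suml -mulr_sumr -[leLHS]mul1r ler_pM2r ?ltr0n //.
apply/negP; rewrite -ltNge.
rewrite -ltr_pdivlMl // mulr1 -lte_fin; apply: le_lt_trans hw.
rewrite (_ : J = [set j | j \in J]); last by apply/seteqP; split=> j /=; rewrite in_setE.
rewrite -nneseries_esum; last first.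
  by move=> j jJ; rewrite lee_fin ltW // w0 //; exact: set_mem.
rewrite -sumEFin; apply: le_trans (nneseries_lim_ge n _).
  by rewrite big_mkord; under eq_bigl do rewrite mem_setE.
by move=> j _ jJ; rewrite lee_fin ltW // w0 //; exact: set_mem.
Qed.

(** * Hausdorff measure *)

Lemma diam2_le (R : realType) (U : set (R * R)) (d : R) : 0 <= d ->
  (forall x y, U x -> U y -> edist2 x y <= d) -> (diam2 U <= d%:E)%E.
Proof.
move=> d0 h; rewrite /diam2 ge_max lee_fin d0 /=.
by apply: ge_ereal_sup => _ [x [y [Ux Uy ->]]]; rewrite lee_fin h.
Qed.

Lemma diam2_ge0 (R : realType) (U : set (R * R)) : (0 <= diam2 U)%E.
Proof. by rewrite /diam2 le_max lexx. Qed.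

Lemma edist2_le_diam2 (R : realType) (U : set (R * R)) x y :
  U x -> U y -> ((edist2 x y)%:E <= diam2 U)%E.
Proof.
move=> Ux Uy; rewrite /diam2 le_max; apply/orP; right.
by apply: ereal_sup_ubound; exists x, y.
Qed.

Lemma edist2_le (R : realType) (x y : R * R) (s : R) :
  `|x.1 - y.1| <= s -> `|x.2 - y.2| <= s -> edist2 x y <= 2 * s.
Proof.
move=> h1 h2; have s0 : 0 <= s by apply: le_trans h1.
have s20 : 0 <= 2 * s by rewrite mulr_ge0.
rewrite /edist2 -[leRHS](ger0_norm s20) -sqrtr_sqr ler_sqrt ?sqr_ge0 //.
rewrite -(real_normK (num_real (x.1 - y.1))) -(real_normK (num_real (x.2 - y.2))).
have n1 : `|x.1 - y.1| ^+ 2 <= s ^+ 2 by apply: lerXn2r; rewrite ?nnegrE.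
have n2 : `|x.2 - y.2| ^+ 2 <= s ^+ 2 by apply: lerXn2r; rewrite ?nnegrE.
have n3 := sqr_ge0 s; rewrite exprMn; lra.
Qed.

Definition finite_cover (R : realType) (s delta C : R) (A : set (R * R)) : Prop :=
  exists (I : finType) (V : I -> set (R * R)) (d : I -> R),
    [/\ A `<=` \bigcup_i V i, forall i, 0 <= d i <= delta,
        forall i x y, V i x -> V i y -> edist2 x y <= d i &
        \sum_i d i `^ s <= C].

Lemma finite_coverU (R : realType) (s delta C1 C2 : R) (A1 A2 : set (R * R)) :
  finite_cover R s delta C1 A1 -> finite_cover R s delta C2 A2 ->
  finite_cover R s delta (C1 + C2) (A1 `|` A2).
Proof.
move=> [I1 [V1 [d1 [c1 h1 e1 s1]]]] [I2 [V2 [d2 [c2 h2 e2 s2]]]].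
exists (I1 + I2)%type, (fun i => match i with inl i => V1 i | inr i => V2 i end),
  (fun i => match i with inl i => d1 i | inr i => d2 i end); split.
- move=> x [/c1 [i _ Vi]|/c2 [i _ Vi]]; first by exists (inl i).
  by exists (inr i).
- by case=> i.
- by case=> i x y; [exact: e1|exact: e2].
- by rewrite big_sumType /= lerD.
Qed.

Lemma finite_cover_hausdorff (R : realType) (s C : R) (A : set (R * R)) : 0 < s ->
  (forall delta, 0 < delta -> finite_cover R s delta C A) ->
  (hausdorff_measure s A <= C%:E)%E.
Proof.
move=> s0 h; apply: ge_ereal_sup => _ [delta /= d0 <-].
have [I [V [d [cV hd he hs]]]] := h delta d0.
(* The finite cover is enumerated and padded with empty sets, which cost nothing because [s] is
   positive. *)
pose U (j : nat) : set (R * R) :=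
  if insub j is Some i then V (@enum_val I predT i) else set0.
pose D (j : nat) : R := if insub j is Some i then d (@enum_val I predT i) else 0.
have D0 j : 0 <= D j.
  by rewrite /D; case: insubP => // i _ _; have /andP[] := hd (enum_val i).
have UD j : (diam2 (U j) <= (D j)%:E)%E.
  apply: diam2_le => // x y; rewrite /U /D; case: insubP => // i _ _; exact: he.
have pUD j : (poweR (diam2 (U j)) s <= (D j `^ s)%:E)%E.
  rewrite -poweR_EFin; apply: gt0_ler_poweR; rewrite ?(ltW s0) // in_itv /= leey andbT.
    exact: diam2_ge0.
  by rewrite lee_fin.
apply: (@le_trans _ _ (\sum_(0 <= j <oo) poweR (diam2 (U j)) s)%E).
  apply: ereal_inf_lbound; exists U; split => //.
  - move=> x /cV [i _ Vi]; exists (enum_rank i) => //.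
    by rewrite /U valK enum_rankK.
  - move=> j; apply: le_trans (UD j) _; rewrite lee_fin /D.
    case: insubP => [i _ _|_]; last exact: ltW.
    by have /andP[] := hd (enum_val i).
apply: lime_le; first by apply: is_cvg_nneseries => n _ _; exact: poweR_ge0.
near=> N.
apply: le_trans (lee_sum _ (fun j _ => pUD j)) _.
rewrite sumEFin lee_fin; apply: le_trans hs.
have NI : (#|I| <= N)%N by near: N; exact: nbhs_infty_ge.
rewrite (big_cat_nat (leq0n _) NI) /= addrC big_nat_cond big1 ?add0r; last first.
  move=> j /andP[/andP[jI _] _]; rewrite /D insubF ?powR0 ?gt_eqF //.
  by apply/negbTE; rewrite -leqNgt.
rewrite big_mkord [leRHS](reindex (@enum_val I predT)) /=; last first.
  exact/onW_bij/enum_val_bij.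
by apply: ler_sum => j _; rewrite /D valK.
Unshelve. all: end_near. Qed.

(** * The four corner Cantor set *)

Section cantor_sum.
Variables (R : realType) (r : R).
Hypotheses (r0 : 0 < r) (r2 : r < 1 / 2).

Definition cantor_partial (a : nat -> bool) (n : nat) : R :=
  \sum_(k < n) (a k)%:R * r ^+ k.

Definition cantor_sum (a : nat -> bool) : R := sup (range (cantor_partial a)).

Let r1 : 0 < 1 - r. Proof. by move: r0 r2; lra. Qed.

Let partialS a n : cantor_partial a n.+1 = cantor_partial a n + (a n)%:R * r ^+ n.
Proof. by rewrite /cantor_partial big_ord_recr. Qed.

Let rn n : 0 < r ^+ n. Proof. exact: exprn_gt0. Qed.

Let bit (a : nat -> bool) n : 0 <= (a n)%:R * r ^+ n <= r ^+ n.
Proof.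
by case: (a n) => /=; rewrite ?mul1r ?mul0r ?lexx ?(ltW (rn n)).
Qed.

Let partial_le a m n :
  cantor_partial a m <= cantor_partial a n + r ^+ n / (1 - r).
Proof.
have t0 k : 0 <= r ^+ k / (1 - r) by rewrite divr_ge0 // ltW.
have [mn|/ltnW nm] := leqP m n.
  apply: ler_wpDr => //; rewrite -(subnK mn); elim: (n - m)%N => // k IH.
  rewrite addSn partialS; apply: le_trans IH _.
  by rewrite lerDl; have /andP[] := bit a (k + m).
apply: (@le_trans _ _ (cantor_partial a m + r ^+ m / (1 - r))).
  exact: ler_wpDr.
rewrite -(subnK nm); elim: (m - n)%N => // k IH; apply: le_trans IH.
rewrite addSn partialS exprS; have /andP[_ h] := bit a (k + n).
rewrite -addrA lerD2l.
apply: (@le_trans _ _ (r ^+ (k + n) + r * r ^+ (k + n) / (1 - r))).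
  by rewrite lerD2r.
by rewrite le_eqVlt; apply/orP; left; apply/eqP; field; rewrite gt_eqF.
Qed.

Let partial_has_sup a : has_sup (range (cantor_partial a)).
Proof.
split; first by exists (cantor_partial a 0), 0%N.
by exists (cantor_partial a 0 + r ^+ 0 / (1 - r)) => _ [m _ <-]; exact: partial_le.
Qed.

Let sum_ge a n : cantor_partial a n <= cantor_sum a.
Proof. by apply: sup_upper_bound => //; exists n. Qed.

Let sum_le a n : cantor_sum a <= cantor_partial a n + r ^+ n / (1 - r).
Proof.
apply: ge_sup; first by exists (cantor_partial a 0), 0%N.
by move=> _ [m _ <-]; exact: partial_le.
Qed.

Let agree_partial a b n : (forall k, (k < n)%N -> a k = b k) ->
  cantor_partial a n = cantor_partial b n.
Proof. by move=> h; apply: eq_bigr => k _; rewrite h. Qed.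

Lemma cantor_sum_close a b n : (forall k, (k < n)%N -> a k = b k) ->
  `|cantor_sum a - cantor_sum b| <= r ^+ n / (1 - r).
Proof.
move=> /agree_partial e; rewrite ler_norml.
have := sum_ge a n; have := sum_le a n; have := sum_ge b n; have := sum_le b n.
rewrite e; lra.
Qed.

(** The first differing digit contributes [r ^+ n], and all later ones can take back at most
    [r ^+ n.+1 / (1 - r)]. *)
Lemma cantor_sum_separated a b n : (forall k, (k < n)%N -> a k = b k) ->
  a n != b n ->
  (1 - 2 * r) / (1 - r) * r ^+ n <= `|cantor_sum a - cantor_sum b|.
Proof.
wlog : a b / a n && ~~ b n => [H h ab|/andP[an bn] h _].
  case an : (a n) ab; case bn : (b n) => // _.
    by apply: H => //; rewrite an bn.
  by rewrite distrC; apply: H; rewrite ?bn ?an // => k /h ->.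
apply: le_trans (ler_norm _).
have h1 := sum_ge a n.+1; have h2 := sum_le b n.+1.
rewrite partialS an mul1r (agree_partial _ _ _ h) in h1.
rewrite partialS (negbTE bn) mul0r addr0 exprS in h2.
have -> : (1 - 2 * r) / (1 - r) * r ^+ n = r ^+ n - r * r ^+ n / (1 - r).
  by field; rewrite gt_eqF.
lra.
Qed.

End cantor_sum.

Section four_corner.
Variable R : realType.

Definition digits (n : nat) (t : R) : nat := `|Num.floor (4 ^+ n * t)|%N.

Lemma digits_ge0 n t : 0 <= t -> (digits n t)%:Z = Num.floor (4 ^+ n * t).
Proof. by move=> t0; rewrite gez0_abs // floor_ge0 mulr_ge0 // exprn_ge0. Qed.

Lemma digitsS n t : 0 <= t -> digits n t = (digits n.+1 t %/ 4)%N.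
Proof.
move=> t0; apply/eqP; rewrite -eqz_nat -divz_nat !digits_ge0 //.
by rewrite exprS -mulrA divz_floor.
Qed.

Lemma digits_agree m n s t : 0 <= s -> 0 <= t -> (m <= n)%N ->
  digits n s = digits n t -> digits m s = digits m t.
Proof.
move=> s0 t0 /subnK <-; elim: (n - m)%N => // k IH e; apply: IH.
by rewrite digitsS // [RHS]digitsS // -addSn e.
Qed.

Lemma digits_lt n t : 0 <= t < 1 -> (digits n t < 4 ^ n)%N.
Proof.
move=> /andP[t0 t1]; rewrite -ltz_nat digits_ge0 // floor_lt_int.
by rewrite -[(_ ^ _)%N%:~R]/((4 ^ n)%N%:R) natrX -[ltRHS]mulr1 ltr_pM2l // exprn_gt0.
Qed.

Lemma digits_dist n s t : 0 <= s -> 0 <= t -> digits n s = digits n t ->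
  `|s - t| <= (4 ^+ n)^-1.
Proof.
move=> s0 t0 e; have p4 : 0 < 4 ^+ n :> R by exact: exprn_gt0.
have /andP[a1 a2] := floor_itv (4 ^+ n * s).
have /andP[b1 b2] := floor_itv (4 ^+ n * t).
rewrite -!digits_ge0 // e intrD in a1 a2; rewrite -!digits_ge0 // intrD in b1 b2.
rewrite -[leRHS]mul1r ler_pdivlMr // -[X in _ * X](gtr0_norm p4) -normrM mulrC.
rewrite mulrBr ler_norml; lra.
Qed.

Lemma digits_eventually_neq s t : 0 <= s -> 0 <= t -> s != t ->
  exists n, digits n s != digits n t.
Proof.
move=> s0 t0 st; apply: contrapT => /forallNP h.
have d0 : 0 < `|s - t| by rewrite normr_gt0 subr_eq0.
have [n hn] : exists n : nat, `|s - t|^-1 < n%:R.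
  by exists (Num.bound `|s - t|^-1); exact: unstable.ltr_bound.
have e : digits n s = digits n t by apply/eqP/negPn/negP/h.
have := digits_dist n s t s0 t0 e; apply/negP; rewrite -ltNge.
have n4 : n%:R <= 4 ^+ n :> R by rewrite -natrX ler_nat; exact: ltnW (ltn_expl _ _).
rewrite -[ltRHS]invrK ltf_pV2 ?posrE ?invr_gt0 ?exprn_gt0 //.
exact: lt_le_trans hn n4.
Qed.

(** The low and the high bit of a base 4 digit of [t]; together they choose one of four corners. *)
Definition bit1 (t : R) (k : nat) : bool := odd (digits k.+1 t).
Definition bit2 (t : R) (k : nat) : bool := odd (digits k.+1 t)./2.

Lemma bits_digits n s t : 0 <= s -> 0 <= t -> digits n s = digits n t ->
  bit1 s n = bit1 t n -> bit2 s n = bit2 t n -> digits n.+1 s = digits n.+1 t.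
Proof.
move=> s0 t0; rewrite /bit1 /bit2 (digitsS n s s0) (digitsS n t t0).
move: (digits n.+1 s) (digits n.+1 t) => x y.
have E z : z = ((z %/ 4) * 4 + (odd z./2 + (odd z./2) + odd z))%N.
  rewrite {1}(divn_eq z 4); congr (_ + _)%N.
  rewrite -{2 3 4}(odd_double_half z) {1}(odd_double_half z).
  lia.
by move=> e e1 e2; rewrite (E x) (E y) e e1 e2.
Qed.

Variables (r : R).
Definition corner (t : R) : R * R :=
  (cantor_sum R r (bit1 t), cantor_sum R r (bit2 t)).

Definition four_corner_set : set (R * R) := corner @` [set t | 0 <= t < 1].

Hypotheses (r0 : 0 < r) (r2 : r < 1 / 2).

Lemma corner_close n s t : 0 <= s -> 0 <= t -> digits n s = digits n t ->
  edist2 (corner s) (corner t) <= 4 * r ^+ n.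
Proof.
move=> s0 t0 e.
have bits k : (k < n)%N -> bit1 s k = bit1 t k /\ bit2 s k = bit2 t k.
  by move=> kn; rewrite /bit1 /bit2 (digits_agree k.+1 n s t).
have hr : r ^+ n / (1 - r) <= 2 * r ^+ n.
  rewrite ler_pdivrMr; last by move: r2; lra.
  by have := exprn_gt0 n r0; move: r2; nra.
have -> : 4 * r ^+ n = 2 * (2 * r ^+ n) by rewrite mulrA -natrM.
apply: edist2_le; apply: le_trans hr.
  by apply: cantor_sum_close => // k /bits[].
by apply: cantor_sum_close => // k /bits[].
Qed.

Lemma corner_separated n s t : 0 <= s -> 0 <= t -> digits n s = digits n t ->
  digits n.+1 s != digits n.+1 t ->
  (1 - 2 * r) / (1 - r) * r ^+ n <= edist2 (corner s) (corner t).
Proof.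
move=> s0 t0 e ne.
have bits k : (k < n)%N -> bit1 s k = bit1 t k /\ bit2 s k = bit2 t k.
  by move=> kn; rewrite /bit1 /bit2 (digits_agree k.+1 n s t).
have [d1 d2] := edist2_ge R (corner s) (corner t).
have [e1|n1] := eqVneq (bit1 s n) (bit1 t n); last first.
  by apply: le_trans d1; apply: cantor_sum_separated => // k /bits[].
apply: le_trans d2; apply: cantor_sum_separated => //; first by move=> k /bits[].
by apply: contraNneq ne => e2; rewrite (bits_digits n s t).
Qed.

Lemma corner_expands (beta : R) s t : 0 < beta -> r `^ beta = 4^-1 ->
  0 <= s < 1 -> 0 <= t < 1 ->
  `|s - t| <= ((1 - r) / (1 - 2 * r)) `^ beta * edist2 (corner s) (corner t) `^ beta.
Proof.
move=> b0 hr /andP[s0 s1] /andP[t0 t1].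
have [->|st] := eqVneq s t.
  by rewrite subrr normr0 mulr_ge0 // powR_ge0.
have c1 : 0 < 1 - r by move: r2 r0; lra.
have c2 : 0 < 1 - 2 * r by move: r2; lra.
have := digits_eventually_neq s t s0 t0 st.
move=> /ex_minnP [[|n]]; first by rewrite /digits !expr0 !mul1r (@floor_def _ s 0) ?(@floor_def _ t 0) //; rewrite ?s0 ?t0.
move=> ne hmin.
have e : digits n s = digits n t.
  by apply/eqP/negPn/negP => /hmin; rewrite ltnn.
apply: le_trans (digits_dist n s t s0 t0 e) _.
have h := corner_separated n s t s0 t0 e ne.
rewrite -powRM ?divr_ge0 ?(ltW c1) ?(ltW c2) ?sqrtr_ge0 //.
have -> : (4 ^+ n)^-1 = (r ^+ n) `^ beta.
  rewrite -powR_mulrn ?(ltW r0) // -powRrM mulrC powRrM hr.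
  by rewrite powR_mulrn ?invr_ge0 // exprVn.
apply: ge0_ler_powR; rewrite ?nnegrE ?(ltW b0) ?exprn_ge0 ?(ltW r0) //.
  by rewrite mulr_ge0 ?sqrtr_ge0 // divr_ge0 // ltW.
rewrite mulrAC ler_pdivlMr // mulrC [leRHS]mulrC -ler_pdivrMr //.
by rewrite mulrAC.
Qed.

Lemma four_corner_finite_cover (beta delta : R) : 0 < beta -> r `^ beta = 4^-1 ->
  0 < delta -> finite_cover R beta delta (4 `^ beta) four_corner_set.
Proof.
move=> b0 hr d0.
have [n hn] : exists n : nat, 4 * r ^+ n <= delta.
  have [n hn] : exists n : nat, 4 / delta < n%:R.
    by exists (Num.bound (4 / delta)); exact: unstable.ltr_bound.
  exists n; have nr : n%:R * r ^+ n <= 1.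
    apply: (@le_trans _ _ (2 ^+ n * r ^+ n)).
      rewrite ler_wpM2r ?exprn_ge0 ?(ltW r0) // -natrX ler_nat.
      exact: ltnW (ltn_expl _ _).
    rewrite -exprMn exprn_ile1 ?mulr_ge0 ?(ltW r0) //; move: r2; lra.
  rewrite ltr_pdivrMr // in hn; have := exprn_gt0 n r0 => rn.
  have : 4 * r ^+ n <= n%:R * delta * r ^+ n by rewrite ler_wpM2r // ltW.
  by move=> h; apply: le_trans h _; nra.
exists ('I_(4 ^ n)),
  (fun i : 'I_(4 ^ n) => corner @` [set t | 0 <= t < 1 /\ digits n t = i]),
  (fun=> 4 * r ^+ n); split.
- move=> _ [t ht <-]; exists (Ordinal (digits_lt n t ht)) => //.
  by exists t.
- by move=> _; rewrite hn mulr_ge0 // exprn_ge0 // ltW.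
- move=> i _ _ [s [/andP[s0 _] si] <-] [t [/andP[t0 _] ti] <-].
  by apply: corner_close => //; rewrite si ti.
- rewrite sumr_const card_ord powRM ?exprn_ge0 ?(ltW r0) //.
  have -> : (r ^+ n) `^ beta = (4 ^+ n)^-1.
    rewrite -powR_mulrn ?(ltW r0) // -powRrM mulrC powRrM hr.
    by rewrite powR_mulrn ?invr_ge0 // exprVn.
  by rewrite -[_ *+ (4 ^ n)]mulr_natr natrX mulfVK ?expf_neq0.
Qed.

End four_corner.

(* [corner] is inverse Hoelder, so a covering of a superset of the four corner
   set pulls back to a covering of [0, 1[ by intervals. *)
Lemma four_corner_hausdorff_gt0 (R : realType) (r beta : R) (A : set (R * R)) :
  0 < r -> r < 1 / 2 -> 0 < beta -> r `^ beta = 4^-1 ->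
  four_corner_set R r `<=` A -> (0 < hausdorff_measure beta A)%E.
Proof.
move=> r0 r2 b0 hr hA.
pose C := ((1 - r) / (1 - 2 * r)) `^ beta.
have C0 : 0 < C by rewrite powR_gt0 // divr_gt0 //; move: r2; lra.
have hC s t := corner_expands R r r0 r2 beta s t b0 hr.
apply: (@lt_le_trans _ _ (hausdorff_pre beta 1 A)); last first.
  by apply: ereal_sup_ubound; exists 1 => //=; exact: ltr01.
apply: (@lt_le_trans _ _ ((2 * C)^-1)%:E).
  by rewrite lte_fin invr_gt0 mulr_gt0.
apply: le_ereal_inf_tmp => _ [U [cU dU ->]].
pose d j := fine (diam2 (U j)).
have dE j : diam2 (U j) = (d j)%:E.
  rewrite fineK // fin_numElt (lt_le_trans _ (diam2_ge0 R (U j))) ?ltNyr //=.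
  by apply: le_lt_trans (dU j) _; rewrite ltry.
have d0 j : 0 <= d j by rewrite -lee_fin -dE; exact: diam2_ge0.
have centers j : exists t : R, forall s, 0 <= s < 1 -> U j (corner R r s) ->
    `|s - t| <= C * d j `^ beta.
  have [[t0 [h0 Ut0]]|no] := pselect (exists t, 0 <= t < 1 /\ U j (corner R r t)).
    exists t0 => s hs Us; apply: le_trans (hC s t0 hs h0) _.
    rewrite ler_pM2l //; apply: ge0_ler_powR; rewrite ?nnegrE ?(ltW b0) ?d0 //.
      exact: sqrtr_ge0.
    by rewrite -lee_fin -dE; exact: edist2_le_diam2.
  by exists 0 => s hs Us; case: no; exists s.
have [t ht] := choice centers.
pose rho j := C * d j `^ beta.
have rho0 j : 0 <= rho j by rewrite mulr_ge0 ?powR_ge0 // ltW.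
pose F j : set R := `[t j - rho j, t j + rho j]%classic.
have cF : (`[0, 1[%classic : set R) `<=` \bigcup_j F j.
  move=> s; rewrite /= in_itv /= => hs.
  have [j _ Us] := cU _ (hA _ (ex_intro2 _ _ s hs erefl)).
  exists j => //; rewrite /F /= in_itv /= -ler_distl; exact: ht.
have e01 : lebesgue_measure (`[0, 1[%classic : set R) = 1%E.
  by rewrite lebesgue_measure_itv /= lte_fin ltr01 oppr0 adde0.
have h1 : (1 <= \sum_(0 <= j <oo) lebesgue_measure (F j))%E.
  rewrite -e01; apply: measure_sigma_subadditive => // j; exact: measurable_itv.
have h2 : (1 <= \sum_(0 <= j <oo) ((2 * C)%:E * poweR (diam2 (U j)) beta))%E.
  apply: le_trans h1 _; apply: lee_nneseries => // j _.
  rewrite lebesgue_measure_itv /= lte_fin dE poweR_EFin -EFinM.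
  case: ifP => _; last by rewrite lee_fin !mulr_ge0 ?powR_ge0 // ltW.
  by rewrite -EFinB lee_fin /rho; lra.
rewrite nneseriesZl in h2; last by move=> j _; exact: poweR_ge0.
have C2 : 0 < 2 * C by rewrite mulr_gt0.
by rewrite -[leLHS]mule1 -lee_pdivlMl ?invr_gt0 // invrK.
Qed.

Lemma cell_finite_cover (R : realType) (beta delta : R) (L : nat)
    (S : int -> int -> bool) :
  0 < beta -> (0 < L)%N -> supported L S -> 2 / L%:R <= delta ->
  (cells L S)%:R <= L%:R `^ beta ->
  finite_cover R beta delta (2 `^ beta) (cell_union R L S).
Proof.
move=> b0 L0 hS hd hc; have LR : 0 < L%:R :> R by rewrite ltr0n.
pose P (ab : 'I_L * 'I_L) := S ab.1%:Z ab.2%:Z.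
exists {ab | P ab}, (fun u : {ab | P ab} => [set p : R * R |
    (sval u).1%:R <= L%:R * p.1 <= (sval u).1%:R + 1 /\
    (sval u).2%:R <= L%:R * p.2 <= (sval u).2%:R + 1]), (fun=> 2 / L%:R); split.
- move=> p [a [b [Sab ha hb]]]; have [/andP[a0 aL] /andP[b0' bL]] := hS a b Sab.
  move: a b a0 aL b0' bL Sab ha hb => [a|//] [b|//] _ aL _ bL Sab ha hb.
  by exists (exist _ (Ordinal (aL : (a < L)%N), Ordinal (bL : (b < L)%N)) Sab).
- by move=> _; rewrite hd divr_ge0 // ltW.
- move=> u x y [/andP[x1 x2] /andP[x3 x4]] [/andP[y1 y2] /andP[y3 y4]].
  have aux (s t z : R) : z <= L%:R * s -> L%:R * s <= z + 1 -> z <= L%:R * t ->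
      L%:R * t <= z + 1 -> `|s - t| <= L%:R^-1.
    move=> h1 h2 h3 h4; rewrite -[leRHS]div1r ler_pdivlMr //.
    rewrite -[X in _ * X](gtr0_norm LR) -normrM mulrC mulrBr ler_norml; lra.
  by apply: edist2_le; [exact: (aux _ _ (sval u).1%:R)|exact: (aux _ _ (sval u).2%:R)].
- rewrite sumr_const card_sig.
  have -> : #|P| = cells L S.
    rewrite -sum1_card big_mkcond /cells /=.
    rewrite (pair_bigA _ (fun a b : 'I_L => nat_of_bool (S a%:Z b%:Z))) /=.
    by apply: eq_bigr => ab _; rewrite unfold_in /P; case: (S _ _).
  rewrite powRM ?invr_ge0 ?ler0n // -[_ *+ cells L S]mulr_natr.
  rewrite -mulrA ler_piMr ?powR_ge0 //.
  apply: (@le_trans _ _ (L%:R^-1 `^ beta * L%:R `^ beta)).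
    by rewrite ler_wpM2l ?powR_ge0.
  by rewrite -powRM ?invr_ge0 ?ler0n // mulVf ?gt_eqF // powR1.
Qed.

Theorem theorem1p4 (R : realType) (beta : R)
    (hbeta : 5 / 3 < beta) (hbeta2 : beta < 2) :
  exists A : set (R * R),
    [/\ (0 < hausdorff_measure beta A)%E,
        (hausdorff_measure beta A < +oo)%E &
        ~ convex_tube_null A].
Proof.
have b0 : 0 < beta by move: hbeta; lra.
have [L [S [E hst]]] := stage_sequence R beta hbeta hbeta2.
pose A1 := \bigcap_i cell_union R (L i) (S i).
pose r : R := 4 `^ (- beta^-1).
have r0 : 0 < r by exact: powR_gt0.
have hr : r `^ beta = 4^-1.
  by rewrite -powRrM mulNr mulVf ?gt_eqF // powR_inv1.
(* After taking logarithms this is [beta < 2]. *)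
have r2 : r < 1 / 2.
  have l2 : 0 < ln 2 :> R by rewrite ln_gt0 // ltr1n.
  have e4 : 4 = 2 ^+ 2 :> R by rewrite -natrX.
  rewrite /r e4 /powR expf_eq0 pnatr_eq0 /= lnXn // div1r.
  rewrite -[X in _ < X^-1]lnK ?posrE // -expRN ltr_expR mulNr ltrN2.
  by rewrite mulrC ltr_pdivlMr // -[ln 2 *+ 2]mulr_natl mulrC ltr_pM2r.
exists (A1 `|` four_corner_set R r); split.
- by apply: (four_corner_hausdorff_gt0 R r beta) => // x; right.
- apply: (@le_lt_trans _ _ (2 `^ beta + 4 `^ beta)%:E); last exact: ltry.
  apply: finite_cover_hausdorff => // delta d0; apply: finite_coverU.
    pose i := Num.bound (2 / delta).
    have [[L0 Li hS _ _ _ hc] _ _ _] := hst i.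
    have hd : 2 / (L i)%:R <= delta.
      rewrite ler_pdivrMr ?ltr0n // mulrC -ler_pdivrMr //.
      by apply: le_trans (ltW (unstable.ltr_bound _)) _; rewrite ler_nat.
    have [I [V [d [h1 h2 h3 h4]]]] :=
      cell_finite_cover R beta delta (L i) (S i) b0 L0 hS hd hc.
    exists I, V, d; split => //; apply: subset_trans h1.
    by move=> p; exact.
  exact: four_corner_finite_cover.
- move=> hnull; apply: (stage_not_tube_null R beta L S E hst) => delta d0.
  have [J [T [w [h1 h2 h3]]]] := hnull delta d0.
  exists J, T, w; split => //; apply: subset_trans h2.
  by move=> p; left.
Qed.
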